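(* Let $\Lambda$ be a geometric Lorenz attractor, with flow $\phi=(\phi_t)_{t\in\mathbb{R}}$ restricted to $\Lambda$, whose one-dimensional return map $f$ on $[0,1]$ satisfies $f(0)\ne0$ or $f(1)\ne1$. Then $\phi$ has no shadowable points, i.e. $Sh(\phi)=\emptyset$.
   Context: Geometric Lorenz attractor. Let $\Phi=(\Phi_t)$ be the flow of a vector field on $\mathbb{R}^3$ with a hyperbolic singularity $\sigma$ near which, in suitable coordinates, the field is linear, $\dot x=\lambda_1x,\ \dot y=-\lambda_2y,\ \dot z=-\lambda_3z$ with $0<\lambda_3<\lambda_1<\lambda_2$. Let $S$ be a square cross-section transverse to the flow, parametrized by $(x,y)\in[0,1]\times[-\tfrac12,\tfrac12]$, meeting the local stable manifold of $\sigma$ in the segment $\Gamma=\{x=c\}$, $0<c<1$, such that every forward orbit starting in $S\setminus\Gamma$ returns to $S$, while points of $\Gamma$ flow to $\sigma$ without returning. The first return map $F:S\setminus\Gamma\to S$ is injective and has the form $F(x,y)=(f(x),g(x,y))$, where: $f:[0,1]\setminus\{c\}\to[0,1]$ is $C^1$ on $[0,c)$ and on $(c,1]$, $f'(x)\to+\infty$ as $x\to c$, $\inf f'>\sqrt2$, $f(c^-)=1$, $f(c^+)=0$, $0\le f(0)<c<f(1)\le1$; and $|\partial g/\partial y|\le\mu$ for some constant $\mu<1$. The map $f$ is the (one-dimensional) return map. The geometric Lorenz attractor is the compact invariant set $\Lambda=\overline{\bigcup_{t\in\mathbb{R}}\Phi_t\big(\bigcap_{n\ge0}\overline{F^n(S)}\big)}$,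 where $F^n(S)$ denotes the image of the points at which $F^n$ is defined, with the flow $\phi=\Phi|_\Lambda$ and the metric $d$ inherited from $\mathbb{R}^3$. Shadowable points. For the flow $\phi$ on the compact metric space $X=\Lambda$: given $\delta,T>0$, a $(\delta,T)$-pseudo-orbit is a sequence $(x_i,t_i)_{i\in\mathbb{Z}}$ in $X\times\mathbb{R}$ with $t_i\ge T$ and $d(\phi_{t_i}(x_i),x_{i+1})\le\delta$ for all $i\in\mathbb{Z}$. It passes through $p$ if $x_0=p$. Put $s_0=0$, $s_i=\sum_{j=0}^{i-1}t_j$ for $i>0$, $s_i=-\sum_{j=i}^{-1}t_j$ for $i<0$, and $x_0\star t=\phi_{t-s_i}(x_i)$ whenever $s_i\le t<s_{i+1}$. $\mathrm{Rep}$ is the set of surjective strictly increasing maps $h:\mathbb{R}\to\mathbb{R}$ with $h(0)=0$. The pseudo-orbit is $\varepsilon$-shadowed if there are $y\in X$ and $h\in\mathrm{Rep}$ with $d(x_0\star t,\phi_{h(t)}(y))\le\varepsilon$ for all $t\in\mathbb{R}$. A point $p\in X$ is shadowable if for every $\varepsilon>0$ there is $\delta>0$ such that every $(\delta,1)$-pseudo-orbit passing through $p$ is $\varepsilon$-shadowed; $Sh(\phi)$ is the set of shadowable points. *)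

(* Defs.v *)
From HB Require Import structures.
From mathcomp Require Import all_boot all_order all_algebra.
From mathcomp Require Import all_classical all_reals all_analysis.

Set Implicit Arguments.
Unset Strict Implicit.
Unset Printing Implicit Defensive.

Import Order.TTheory GRing.Theory Num.Theory.
Import numFieldNormedType.Exports.

Local Open Scope classical_set_scope.
Local Open Scope ring_scope.

Section Shadowing.
Context {R : realType} {T : Type}.
Variables (d : T -> T -> R) (X : set T) (phi : R -> T -> T).

Definition pseudo_orbit (delta T0 : R) (x : int -> T) (t : int -> R) : Prop :=
  forall i : int,
    [/\ X (x i), T0 <= t i & d (phi (t i) (x i)) (x (i + 1)) <= delta].

(* Negz j is the integer -(j+1), so that the second sum runs over
   -(n+1), ..., -1. *)
Definition switch_time (t : int -> R) (i : int) : R :=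
  match i with
  | Posz n => \sum_(j < n) t (Posz j)
  | Negz n => - \sum_(j < n.+1) t (Negz j)
  end.

Definition Rep : set (R -> R) :=
  [set h | [/\ {homo h : a b / a < b}, (forall u, exists v, h v = u)
             & h 0 = 0]].

Definition shadowed (eps : R) (x : int -> T) (t : int -> R) : Prop :=
  exists y h, [/\ X y, Rep h &
    forall (u : R) (i : int), switch_time t i <= u < switch_time t (i + 1) ->
      d (phi (u - switch_time t i) (x i)) (phi (h u) y) <= eps].

Definition Sh : set T :=
  [set p | X p /\ forall eps : R, 0 < eps -> exists2 delta : R, 0 < delta &
     forall x t, pseudo_orbit delta 1 x t -> x 0 = p -> shadowed eps x t].

End Shadowing.

Section Flows.
Context {R : realType}.
Local Notation R3 := 'rV[R]_3.

(* The library norm on R3 is the sup norm; the metric is the Euclidean one. *)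
Definition euclidean_dist (p q : R3) : R :=
  Num.sqrt (\sum_(i < 3) (p 0 i - q 0 i) ^+ 2).

Definition C1_on (E E' : normedModType R) (U : set E) (h : E -> E') : Prop :=
  forall p, U p ->
    differentiable h p /\ forall v, {for p, continuous (fun q => 'd h q v)}.

Definition flow_of (V : R3 -> R3) (Phi : R -> R3 -> R3) : Prop :=
  [/\ forall p, Phi 0 p = p,
      forall s t p, Phi (s + t) p = Phi s (Phi t p),
      continuous (fun tp : R * R3 => Phi tp.1 tp.2)
    & forall p t, is_derive t (1 : R) (fun s : R => Phi s p) (V (Phi t p))].

Definition diag_field (l1 l2 l3 : R) (q : R3) : R3 :=
  \row_(j < 3) ([:: l1; - l2; - l3]`_j * q 0 j).

(* The coordinates are a C^1 diffeomorphism k from a neighbourhood U of sigma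
   onto an open neighbourhood of 0.  Hyperbolicity of sigma is contained in
   the normal form, whose eigenvalues l1, -l2, -l3 are real and nonzero. *)
Definition lorenz_singularity (V : R3 -> R3) (sigma : R3) : Prop :=
  V sigma = 0 /\
  exists (l1 l2 l3 : R) (U : set R3) (k : R3 -> R3),
    [/\ [/\ 0 < l3, l3 < l1 & l1 < l2],
        open U /\ U sigma,
        C1_on U k /\ k sigma = 0,
        {in U &, injective k} /\ (forall p, U p -> injective ('d k p))
      & forall p, U p -> 'd k p (V p) = diag_field l1 l2 l3 (k p)].

Definition local_stable_set (Phi : R -> R3 -> R3) (W : set R3) (sigma : R3) :
    set R3 :=
  [set p | (forall t, 0 <= t -> W (Phi t p)) /\
           Phi t p @[t --> +oo] --> sigma].

Definition first_return_time (Phi : R -> R3 -> R3) (S : set R3) (p : R3)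
    (t : R) : Prop :=
  [/\ 0 < t, S (Phi t p) & forall s, 0 < s < t -> ~ S (Phi s p)].

Definition square : set (R * R) := `[0, 1] `*` `[- 2^-1, 2^-1].

Definition segment (c : R) : set (R * R) := square `&` [set p | p.1 = c].

(* sec is a C^1 embedding of the square, defined and C^1 on a neighbourhood of
   it so that derivatives make sense up to the boundary. *)
Definition transverse_section (V : R3 -> R3) (sec : R * R -> R3) : Prop :=
  [/\ exists O : set (R * R), [/\ open O, square `<=` O & C1_on O sec],
      {in square &, injective sec},
      forall p, square p -> injective ('d sec p)
    & forall p, square p -> forall v, 'd sec p v <> V (sec p)].

(* Derivative at x of the restriction of h to D (one-sided at end points). *)
Definition derivative_within (D : set R) (h : R -> R) (x l : R) : Prop :=
  (h y - h x) / (y - x) @[y --> within D x^'] --> l.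

Definition C1_within (D : set R) (h dh : R -> R) : Prop :=
  (forall x, D x -> derivative_within D h x (dh x)) /\
  {within D, continuous dh}.

Definition lorenz_map (c : R) (f : R -> R) : Prop :=
  (forall x, (`[0, 1] `\ c) x -> 0 <= f x <= 1) /\
  (exists df : R -> R,
    [/\ C1_within `[0, c[ f df, C1_within `]c, 1] f df,
        df x @[x --> c^'] --> +oo
      & Num.sqrt 2 < inf (df @` (`[0, 1] `\ c))]) /\
  [/\ f x @[x --> c^'-] --> (1 : R), f x @[x --> c^'+] --> (0 : R),
      0 <= f 0 < c & c < f 1 <= 1].

Definition fiber_contraction (c : R) (g : R -> R -> R) : Prop :=
  exists2 mu : R, mu < 1 &
    forall x y, (`[0, 1] `\ c) x -> - 2^-1 <= y <= 2^-1 ->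
      exists2 l, derivative_within `[- 2^-1, 2^-1] (g x) y l & `|l| <= mu.

Definition skew (f : R -> R) (g : R -> R -> R) (p : R * R) : R * R :=
  (f p.1, g p.1 p.2).

(* F^n(S) in the coordinates of the square: the image under F^n of the points
   none of whose first n iterates is on the segment. *)
Definition iter_image (c : R) (F : R * R -> R * R) (n : nat) : set (R * R) :=
  iter n F @` [set p | square p /\
    forall k, (k < n)%N -> (square `\` segment c) (iter k F p)].

Definition attractor (Phi : R -> R3 -> R3) (sec : R * R -> R3) (c : R)
    (F : R * R -> R * R) : set R3 :=
  closure (\bigcup_(t in [set: R])
    (Phi t @` \bigcap_(n in [set: nat]) closure (sec @` iter_image c F n))).

End Flows.

(* f, g and sec are total functions; only their values on [0,1] \ {c},
   ([0,1] \ {c}) x [-1/2,1/2] and a neighbourhood of the square matter. *)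
Record geometric_lorenz (R : realType) := GeometricLorenz {
  gl_field : 'rV[R]_3 -> 'rV[R]_3;
  gl_flow : R -> 'rV[R]_3 -> 'rV[R]_3;
  gl_sing : 'rV[R]_3;
  gl_sec : R * R -> 'rV[R]_3;
  gl_c : R;
  gl_f : R -> R;
  gl_g : R -> R -> R;
  gl_S := gl_sec @` square;
  gl_Gamma := gl_sec @` segment gl_c;
  gl_F := skew gl_f gl_g;
  gl_attractor := attractor gl_flow gl_sec gl_c gl_F;
  gl_fieldP : C1_on setT gl_field;
  gl_flowP : flow_of gl_field gl_flow;
  gl_singP : lorenz_singularity gl_field gl_sing;
  gl_secP : transverse_section gl_field gl_sec;
  gl_cP : 0 < gl_c < 1;
  gl_stableP : exists2 W, nbhs gl_sing W &
    gl_S `&` local_stable_set gl_flow W gl_sing = gl_Gamma;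
  gl_GammaP : forall p t, gl_Gamma p -> 0 < t -> ~ gl_S (gl_flow t p);
  gl_returnP : forall p, (square `\` segment gl_c) p ->
    square (gl_F p) /\
    exists2 t, first_return_time gl_flow gl_S (gl_sec p) t &
               gl_flow t (gl_sec p) = gl_sec (gl_F p);
  gl_injP : {in square `\` segment gl_c &, injective gl_F};
  gl_fP : lorenz_map gl_c gl_f;
  gl_gP : fiber_contraction gl_c gl_g;
  gl_compactP : compact gl_attractor
}.

(* Main.v *)
Require Import Defs.
From mathcomp Require Import all_boot all_order all_algebra.
From mathcomp Require Import all_classical all_reals all_analysis.
From mathcomp Require Import lra zify.

(* A pseudo-orbit may rest at the singularity sigma before some instant and
   after another one.  Reparametrizations are onto, so an orbit shadowing it
   stays near sigma in the distant past and in the distant future.  In the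
   linearizing coordinates the first fact puts the orbit on the expanding axis
   of sigma, which consists of sigma and of two orbits; the second one makes it
   homoclinic, so that it alternates only finitely often between small balls
   around sigma and around another point b of the attractor.  Hence the number
   of alternations is bounded over all such shadowing orbits.  But chains lead
   from sigma to any point of the attractor and back, so that through any p
   there are arbitrarily fine pseudo-orbits resting at sigma at both ends and
   making any number of loops from sigma to b and back: p is not shadowable.

   The chains come from the return map F(x, y) = (f x, g x y) without using its
   continuity.  Slope > sqrt 2 makes f eventually onto.  A point p of the core
   is close to F^n(x, y) for some large n and all y, by contraction of the
   leaves.  If points of the core lie over x_k -> x, they accumulate at a point
   over x, so by continuity of the flow some of their orbits pass near p.
   Choosing x_k among the preimages of the discontinuity c, or among the images
   of points close to c, gives the chains to and from sigma. *)

Set Implicit Arguments.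
Unset Strict Implicit.
Unset Printing Implicit Defensive.

Import Order.TTheory GRing.Theory Num.Theory.
Import numFieldNormedType.Exports.
Local Open Scope classical_set_scope.
Local Open Scope ring_scope.

(** * Derivatives within a set and expansion on the branches *)

Lemma near_derivative_within (R : realType) (D : set R) (h : R -> R) x l e :
  derivative_within D h x l -> 0 < e ->
  \forall y \near x, D y -> y != x -> `|l - (h y - h x) / (y - x)| < e.
Proof.
move=> /cvgrPdist_lt dh e0.
have {}dh : \forall y \near x, y != x -> D y -> `|l - (h y - h x) / (y - x)| < e.
  exact: dh e0.
by apply: filterS dh => y /[swap] Dy /[swap] yx; apply.
Qed.

Lemma derivative_within_is_derive (R : realType) (D : set R) (h : R -> R) x l :
  nbhs x D -> derivative_within D h x l -> is_derive x (1 : R) h l.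
Proof.
move=> xD dh.
suff hl : e^-1 *: ((h \o shift x) (e *: 1) - h x) @[e --> (0 : R)^'] --> l.
  by split; [apply/cvg_ex; exists l|exact/cvg_lim].
apply/cvgrPdist_lt => e e0.
have [d /= d0 dP] := filterI xD (near_derivative_within dh e0).
exists d => //= y; rewrite /ball_ /= sub0r normrN => yd y0.
have := dP (y + x); rewrite /ball_ /= opprD addrCA subrr addr0 normrN addrK.
rewrite [_ *: 1]mulr1 [_ *: _]mulrC => /(_ yd)[Dy]; apply => //.
by rewrite -subr_eq0 addrK.
Qed.

Lemma derivative_within_continuous (R : realType) (D : set R) (h : R -> R) x l :
  derivative_within D h x l -> h y @[y --> within D (nbhs x)] --> h x.
Proof.
move=> /near_derivative_within/(_ ltr01) dh.
apply/cvgrPdist_lt => e e0.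
(* Near [x] the difference quotients differ from [l] by less than 1, so [h] is Lipschitz at [x] with
   constant [|l| + 1]. *)
have M0 : 0 < `|l| + 1 by rewrite ltr_wpDl.
have xe : nbhs x (ball x (e / (`|l| + 1))) by apply: nbhsx_ballx; rewrite divr_gt0.
suff : \forall y \near x, D y -> `|h x - h y| < e by [].
apply: filterS (filterI xe dh) => y [xy dy] Dy.
have [->|yx] := eqVneq y x; first by rewrite subrr normr0.
move: xy; rewrite /ball /= ltr_pdivlMr// => xy.
apply: le_lt_trans xy.
have yx0 : y - x != 0 by rewrite subr_eq0.
rewrite [`|h x - _|]distrC [`|x - _|]distrC -[h y - h x](divfK yx0) normrM mulrC.
rewrite ler_wpM2l//.
have := ltW (dy Dy yx); rewrite distrC => dl.
by rewrite -[X in `|X|](subrK l) (le_trans (ler_normD _ _))// addrC lerD2l.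
Qed.

Lemma within_mvt (R : realType) (D : set R) (h dh : R -> R) (a b : R) :
  a < b -> `]a, b[ `<=` D -> {within `[a, b], continuous h} ->
  (forall x, a < x < b -> derivative_within D h x (dh x)) ->
  exists2 x, a < x < b & h b - h a = dh x * (b - a).
Proof.
move=> ab abD ch dhP; have [x xab|x xab E] := @MVT _ h dh _ _ ab _ ch.
  apply: (@derivative_within_is_derive _ D); last by apply: dhP; rewrite in_itv in xab.
  by apply: (filterS abD); exact: near_in_itvoo xab.
by exists x => //; move: xab; rewrite in_itv.
Qed.

(* Completes a branch of the return map by its one-sided limit [v] at the
   discontinuity [e], where the slope is infinite. *)
Definition extension (R : realType) (e v : R) (h : R -> R) : R -> R :=
  fun x => if x == e then v else h x.

Lemma extension_continuous (R : realType) (D : set R) (e v : R) (h dh : R -> R) :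
  (forall x, (D `\ e) x -> derivative_within (D `\ e) h x (dh x)) ->
  h y @[y --> within (D `\ e) (nbhs e)] --> v ->
  {within D, continuous (extension e v h)}.
Proof.
move=> dhP hv; apply/subspace_continuousP => x Dx.
have xE : (x == e = false) -> h y @[y --> within (D `\ e) (nbhs x)] --> h x.
  by move=> xe; apply: derivative_within_continuous (dhP x _); split => // /eqP; rewrite xe.
have {xE hv} hx : h y @[y --> within (D `\ e) (nbhs x)] --> extension e v h x.
  by rewrite /extension; case: eqP => [->//|/eqP/negbTE/xE].
apply/cvgrPdist_lt => r r0; move/cvgrPdist_lt : hx => /(_ r r0) hx.
have {}hx : \forall y \near x, (D `\ e) y -> `|extension e v h x - h y| < r by exact: hx.
suff : \forall y \near x, D y -> `|extension e v h x - extension e v h y| < r by [].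
have [xe|xe] := eqVneq x e.
  apply: filterS hx => y hy Dy; have [->|ye] := eqVneq y e.
    by rewrite xe subrr normr0.
  by rewrite {2}/extension (negbTE ye); apply: hy; split => //; exact/eqP.
have /filterI/(_ hx) : \forall y \near x, y != e.
  by apply: open_neq.
apply: filterS => y [ye hy] Dy.
by rewrite {2}/extension (negbTE ye); apply: hy; split => //; exact/eqP.
Qed.

(** Since [e] is an end point of [[a, b]], the open interval []x, y[] misses it. The mean value
    theorem thus asks only for continuity at [e], which the extension has. *)
Lemma extension_expands (R : realType) (a b e v l : R) (h dh : R -> R) :
  (e == a) || (e == b) ->
  (forall x, (`[a, b] `\ e) x -> derivative_within (`[a, b] `\ e) h x (dh x)) ->
  (forall x, (`[a, b] `\ e) x -> l <= dh x) ->
  h y @[y --> within (`[a, b] `\ e) (nbhs e)] --> v ->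
  forall x y, a <= x -> x < y -> y <= b ->
    l * (y - x) <= extension e v h y - extension e v h x.
Proof.
move=> eab dhP ldh hv x y ax xy yb.
have inD z : x < z < y -> (`[a, b] `\ e) z.
  move=> /andP[xz zy]; split=> [|ze].
    by rewrite /= in_itv /= (le_trans ax (ltW xz)) (le_trans (ltW zy) yb).
  by move: eab; rewrite -ze; case/orP => /eqP E; move: xz zy ax yb; rewrite E; lra.
have [z xyz ->] : exists2 z, x < z < y &
    extension e v h y - extension e v h x = dh z * (y - x).
  apply: (@within_mvt _ (`[a, b] `\ e)) => //.
  - apply: (continuous_subspaceW _ (extension_continuous dhP hv)) => z /=.
    by rewrite !in_itv /= => /andP[xz zy]; rewrite (le_trans ax xz) (le_trans zy yb).
  - move=> z /inD Dz; have ze : z != e by case: Dz => _ /eqP.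
    move/cvgrPdist_lt : (dhP z Dz) => D; apply/cvgrPdist_lt => r /D {}D.
    have {}D : \forall t \near z, t != z -> (`[a, b] `\ e) t ->
      `|dh z - (h t - h z) / (t - z)| < r by exact: D.
    suff : \forall t \near z, t != z -> (`[a, b] `\ e) t ->
      `|dh z - (extension e v h t - extension e v h z) / (t - z)| < r by [].
    apply: filterS D => t Dt tz Dt'; rewrite /extension (negbTE ze).
    by case: eqP => [te|_]; [case: Dt'|exact: Dt].
by apply: ler_wpM2r; [rewrite subr_ge0 ltW|exact/ldh/inD].
Qed.

(** * Expanding maps with one discontinuity *)

Lemma small_power (R : realType) (q e : R) :
  0 <= q < 1 -> 0 < e -> exists n, q ^+ n < e.
Proof.
move=> /andP[q0 q1] e0; have : `|q| < 1 by rewrite ger0_norm.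
move=> /cvg_expr/cvgrPdist_lt/(_ e e0)[N _ /(_ N (leqnn N))] /=.
by rewrite sub0r normrN ger0_norm ?exprn_ge0// => ?; exists N.
Qed.

(** This makes the first [n] returns defined on the whole leaf over [x]. The [n]-th iterate itself
    may be [c], as it is for points about to hit the stable segment. *)
Definition avoids (R : realType) (c : R) (f : R -> R) n x :=
  forall k, (k < n)%N -> iter k f x <> c.

Section ExpandingMap.
Variables (R : realType) (c : R) (f : R -> R) (l : R).
Let fl := extension c 1 f.
Let fr := extension c 0 f.
Hypothesis hc : 0 < c < 1.
Hypothesis l1 : 1 < l.
Hypothesis l2 : 2 < l * l.
Hypothesis flc : {within `[0, c], continuous fl}.
Hypothesis frc : {within `[c, 1], continuous fr}.
Hypothesis flx : forall x y, 0 <= x -> x < y -> y <= c -> l * (y - x) <= fl y - fl x.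
Hypothesis frx : forall x y, c <= x -> x < y -> y <= 1 -> l * (y - x) <= fr y - fr x.
Hypothesis f0 : 0 <= f 0 < c.
Hypothesis f1 : c < f 1 <= 1.

Let extE (x v : R) : x != c -> extension c v f x = f x.
Proof. by rewrite /extension => /negbTE->. Qed.
Let ext_c (v : R) : extension c v f c = v.
Proof. by rewrite /extension eqxx. Qed.
Let l0 : 0 < l. Proof. exact: lt_trans ltr01 l1. Qed.
Let fl0 : fl 0 = f 0. Proof. by apply: extE; case/andP: hc => /lt_eqF ->. Qed.
Let fr1 : fr 1 = f 1. Proof. by apply: extE; case/andP: hc => _ /gt_eqF ->. Qed.

Let left_onto u w y : 0 <= u -> u < w -> w <= c -> fl u < y < fl w ->
  exists x, u < x < w /\ f x = y.
Proof.
move=> u0 uw wc /andP[uy yw].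
have [||x] := @IVT _ fl u w y (ltW uw).
- apply: continuous_subspaceW flc => z /=.
  by rewrite !in_itv /= => /andP[uz zw]; rewrite (le_trans u0 uz) (le_trans zw wc).
- by rewrite ge_min (ltW uy) /= le_max (ltW yw) orbT.
rewrite in_itv /= => /andP[ux xw] fx.
have {}ux : u < x by rewrite lt_neqAle ux andbT; apply: contraTN uy => /eqP ->; rewrite fx ltxx.
have {}xw : x < w by rewrite lt_neqAle xw andbT; apply: contraTN yw => /eqP <-; rewrite fx ltxx.
exists x; split; first by rewrite ux.
by rewrite -fx /fl extE// lt_eqF// (lt_le_trans xw).
Qed.

Let right_onto u w y : c <= u -> u < w -> w <= 1 -> fr u < y < fr w ->
  exists x, u < x < w /\ f x = y.
Proof.
move=> u0 uw wc /andP[uy yw].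
have [||x] := @IVT _ fr u w y (ltW uw).
- apply: continuous_subspaceW frc => z /=.
  by rewrite !in_itv /= => /andP[uz zw]; rewrite (le_trans u0 uz) (le_trans zw wc).
- by rewrite ge_min (ltW uy) /= le_max (ltW yw) orbT.
rewrite in_itv /= => /andP[ux xw] fx.
have {}ux : u < x by rewrite lt_neqAle ux andbT; apply: contraTN uy => /eqP ->; rewrite fx ltxx.
have {}xw : x < w by rewrite lt_neqAle xw andbT; apply: contraTN yw => /eqP <-; rewrite fx ltxx.
exists x; split; first by rewrite ux.
by rewrite -fx /fr extE// gt_eqF// (le_lt_trans u0).
Qed.

(** The left branch covers []f 0, 1[] and the right one []0, f 1[]; these overlap because
    [f 0 < c < f 1]. *)
Lemma expanding_preimage y : 0 < y < 1 -> exists x, [/\ 0 < x < 1, x <> c & f x = y].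
Proof.
move=> /andP[y0 y1]; have [fy|yf] := ltP (f 0) y.
  have [||x [/andP[x0 xc] fx]] := @left_onto 0 c y (lexx _) _ (lexx _).
  - by case/andP: hc.
  - by rewrite fl0 fy /fl ext_c.
  exists x; split => //; first by move: hc; lra.
  by move/eqP; rewrite lt_eqF.
have [||x [/andP[x0 xc] fx]] := @right_onto c 1 y (lexx _) _ (lexx _).
- by case/andP: hc.
- by rewrite fr1 /fr ext_c y0; move: f0 f1; lra.
exists x; split => //; first by move: hc; lra.
by move/eqP; rewrite gt_eqF.
Qed.

Lemma expanding_backward_orbit n y : 0 < y < 1 ->
  exists x, [/\ 0 < x < 1, avoids c f n x & iter n f x = y].
Proof.
elim: n y => [|n IH] y y01; first by exists y; split.
have [z [z01 zc fz]] := expanding_preimage y01.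
have [x [x01 ax ex]] := IH z z01.
exists x; split => //; last by rewrite iterS ex.
move=> k; rewrite ltnS leq_eqVlt => /orP[/eqP ->|/ax//].
by rewrite ex.
Qed.

(** The number of iterates depends on [y], so pieces of []0, 1[] swept at different times can be
    united. *)
Definition reaches (u w y : R) :=
  exists n x, [/\ u < x < w, avoids c f n x & iter n f x = y].

Let covers (u w a b : R) := forall y, a < y < b -> reaches u w y.

Let reachesS u w x : reaches u w x -> x != c -> reaches u w (f x).
Proof.
move=> [n [z [zuw az ez]]] /eqP xc; exists n.+1, z; split => //; last by rewrite iterS ez.
move=> k; rewrite ltnS leq_eqVlt => /orP[/eqP ->|/az//].
by rewrite ez.
Qed.

Let covers_left u w a b : 0 <= a -> a < b -> b <= c ->
  covers u w a b -> covers u w (fl a) (fl b).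
Proof.
move=> a0 ab bc ch y /(left_onto a0 ab bc)[x [xab <-]].
by apply: reachesS (ch _ xab) _; rewrite lt_eqF//; move: xab; lra.
Qed.

Let covers_right u w a b : c <= a -> a < b -> b <= 1 ->
  covers u w a b -> covers u w (fr a) (fr b).
Proof.
move=> a0 ab bc ch y /(right_onto a0 ab bc)[x [xab <-]].
by apply: reachesS (ch _ xab) _; rewrite gt_eqF//; move: xab; lra.
Qed.

Let covers_sub u w a b a' b' : a <= a' -> b' <= b -> covers u w a b -> covers u w a' b'.
Proof. by move=> aa bb ch y y1; apply: ch; move: y1; lra. Qed.

Let fl_le a b : 0 <= a -> a <= b -> b <= c -> fl a <= fl b.
Proof.
rewrite le_eqVlt => a0; rewrite le_eqVlt => /orP[/eqP->//|ab bc].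
have := flx _ ab bc; rewrite le_eqVlt => /(_ a0).
have : 0 <= l * (b - a) by rewrite mulr_ge0 ?subr_ge0 ?ltW.
lra.
Qed.

Let fr_le a b : c <= a -> a <= b -> b <= 1 -> fr a <= fr b.
Proof.
move=> a0; rewrite le_eqVlt => /orP[/eqP->//|ab bc].
have := frx a0 ab bc.
have : 0 <= l * (b - a) by rewrite mulr_ge0 ?subr_ge0 ?ltW.
lra.
Qed.

(* The only loss of length is the factor 2 when the interval is cut at [c];
   one half is then mapped to an interval ending at 0 or 1, so that the next
   step either does not cut or has already swept everything. *)
Let covers_grow u w a b r : 0 <= r -> r <= l -> 2 * r <= l * l ->
  0 <= a -> a < b -> b <= 1 -> covers u w a b ->
  (forall y, 0 < y < 1 -> reaches u w y) \/
  exists a' b', [/\ 0 <= a', b' <= 1, r * (b - a) <= b' - a' & covers u w a' b'].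
Proof.
move=> r0 rl rl2 a0 ab b1 ch; case/andP: hc => c0 c1.
have flcE : fl c = 1 by rewrite /fl ext_c.
have frcE : fr c = 0 by rewrite /fr ext_c.
have r1 x y : x < y -> r * (y - x) <= l * (y - x).
  by move=> xy; apply: ler_wpM2r => //; lra.
(* Two successive stretchings by [l] of a half of length [z] make up for the cut, since
   [2 * r <= l * l]. *)
have r2 x y z : x < y -> y - x <= 2 * z -> r * (y - x) <= l * (l * z).
  move=> xy yz; have -> : l * (l * z) = (l * l) * z by rewrite mulrA.
  have z0 : 0 < z by lra.
  apply: (@le_trans _ _ (2 * r * z)); last by apply: ler_wpM2r => //; lra.
  by rewrite [2 * r]mulrC -mulrA; apply: ler_wpM2l.
have [bc|cb] := leP b c.
  right; exists (fl a), (fl b); split.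
  - by rewrite (le_trans _ (fl_le (lexx _) a0 _)) ?fl0; move: f0; lra.
  - by rewrite -flcE fl_le //; lra.
  - by apply: le_trans (r1 _ _ ab) _; exact: flx.
  - exact: covers_left.
have [ca|ac] := leP c a.
  right; exists (fr a), (fr b); split.
  - by rewrite -frcE fr_le //; lra.
  - by apply: (le_trans (fr_le _ b1 (lexx _))); rewrite ?fr1; move: f1; lra.
  - by apply: le_trans (r1 _ _ ab) _; exact: frx.
  - exact: covers_right.
have [half|half] := leP (b - a) (2 * (c - a)).
  have chl : covers u w (fl a) 1.
    by rewrite -flcE; apply: covers_left => //; apply: covers_sub ch; lra.
  have lfa := flx a0 ac (lexx _); rewrite flcE in lfa.
  have lca : 0 < l * (c - a) by rewrite mulr_gt0 ?subr_gt0.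
  (* If [fl a < c], the image []fl a, 1[] contains []c, 1[], which the right branch sends onto []0,
     f 1[]. As [fl a < c < f 1], these two intervals cover []0, 1[]. *)
  have [fac|cfa] := ltP (fl a) c.
    left => y /andP[y0 y1]; have [yf|fy] := ltP y (f 1).
      suff : covers u w 0 (f 1) by apply; rewrite y0.
      rewrite -frcE -fr1; apply: covers_right => //.
      by apply: covers_sub chl => //; exact: ltW.
    by apply: chl; move: f1; lra.
  right; exists (fr (fl a)), (fr 1); split.
  - by rewrite -frcE fr_le //; lra.
  - by rewrite fr1; case/andP: f1.
  - apply: (@le_trans _ _ (l * (1 - fl a))); last by apply: frx; lra.
    apply: le_trans (r2 _ _ _ ab half) _; apply: ler_wpM2l; lra.
  - by apply: covers_right => //; lra.
have chr : covers u w 0 (fr b).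
  by rewrite -frcE; apply: covers_right => //; apply: covers_sub ch; lra.
have lfb := frx (lexx _) cb b1; rewrite frcE in lfb.
have lcb : 0 < l * (b - c) by rewrite mulr_gt0 ?subr_gt0.
have [fbc|cfb] := ltP c (fr b).
  left => y /andP[y0 y1]; have [yf|fy] := ltP (f 0) y.
    suff : covers u w (f 0) 1 by apply; rewrite yf.
    rewrite -flcE -fl0; apply: covers_left => //.
    by apply: covers_sub chr => //; exact: ltW.
  by apply: chr; move: f0; lra.
right; exists (fl 0), (fl (fr b)); split.
- by rewrite fl0; case/andP: f0.
- by rewrite -flcE fl_le //; lra.
- apply: (@le_trans _ _ (l * (fr b - 0))); last by apply: flx; lra.
  apply: (le_trans (r2 _ _ (b - c) ab _)); first lra.
  by apply: ler_wpM2l; lra.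
- by apply: covers_left => //; lra.
Qed.

(** Otherwise the swept intervals would lengthen forever by a fixed factor greater than 1 while
    staying inside [[0, 1]]. *)
Lemma expanding_eventually_onto u w y :
  0 <= u -> u < w -> w <= 1 -> 0 < y < 1 -> reaches u w y.
Proof.
move=> u0 uw w1; move: y; apply: contrapT => nall.
(* A step without a cut gains [l]; a cut followed by a second step gains [l * l / 2]. *)
pose r := Num.min l (l * l / 2).
have r1 : 1 < r by rewrite lt_min l1 /=; move: l2; lra.
have rl : r <= l by rewrite ge_min lexx.
have rl2 : 2 * r <= l * l.
  by have : r <= l * l / 2 by [rewrite ge_min lexx orbT]; lra.
have grow n : exists a b, [/\ 0 <= a, b <= 1, r ^+ n * (w - u) <= b - a & covers u w a b].
  elim: n => [|n [a [b [a0 b1 ab ch]]]].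
    exists u, w; split=> //; first by rewrite expr0 mul1r.
    by move=> y yuw; exists 0%N, y; split.
  have ab0 : a < b.
    have : 0 < r ^+ n * (w - u) by apply: mulr_gt0; rewrite ?subr_gt0// exprn_gt0//; lra.
    lra.
  have [//|[a' [b' [a'0 b'1 ab' ch']]]] := covers_grow (ltW (lt_trans ltr01 r1)) rl rl2 a0 ab0 b1 ch.
  exists a', b'; split => //; apply: le_trans ab'; rewrite exprS -mulrA ler_wpM2l//; lra.
have q1 : 0 <= r^-1 < 1 by rewrite invr_ge0 invf_lt1 ?r1 ?andbT; lra.
have wu : 0 < w - u by rewrite subr_gt0.
have [n] := small_power q1 wu.
have [a [b [a0 b1 ab _]]] := grow n.
rewrite exprVn -[_^-1]mul1r ltr_pdivrMr; last by rewrite exprn_gt0 // (lt_trans ltr01).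
rewrite mulrC; lra.
Qed.

End ExpandingMap.

Lemma lorenz_map_expanding (R : realType) (c : R) (f : R -> R) :
  0 < c < 1 -> lorenz_map c f -> exists l : R,
    [/\ 1 < l, 2 < l * l,
      {within `[0, c], continuous (extension c 1 f)} /\
      {within `[c, 1], continuous (extension c 0 f)},
      (forall x y, 0 <= x -> x < y -> y <= c ->
         l * (y - x) <= extension c 1 f y - extension c 1 f x) &
      (forall x y, c <= x -> x < y -> y <= 1 ->
         l * (y - x) <= extension c 0 f y - extension c 0 f x)].
Proof.
move=> /andP[c0 c1] [_ [[df [[dfl _] [dfr _] _]]]]; set l := inf _ => l2 [fc1 fc0 _ _].
have s0 : 0 <= Num.sqrt 2 :> R by exact: sqrtr_ge0.
have s2 : Num.sqrt 2 * Num.sqrt 2 = 2 :> R by rewrite -expr2 sqr_sqrtr.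
have ldf x : (`[0, 1] `\ c) x -> l <= df x.
  move=> Dx; apply: ge_inf; last by exists x.
  (* Without an infimum [inf] takes its default value 0, which contradicts [Num.sqrt 2 < l]. *)
  have [[]//|/inf_out l0] := pselect (has_inf (df @` (`[0, 1] `\ c))).
  by move: l2; rewrite /l l0; lra.
have Dl : `[0, c[%classic = `[0, c] `\ c :> set R.
  rewrite eqEsubset; split => y; rewrite /= !in_itv /=.
    by move=> /andP[y0 yc]; rewrite y0 ltW//; split => // ye; move: yc; rewrite ye ltxx.
  by move=> [/andP[-> yc] /eqP ye]; rewrite lt_neqAle ye.
have Dr : `]c, 1]%classic = `[c, 1] `\ c :> set R.
  rewrite eqEsubset; split => y; rewrite /= !in_itv /=.
    by move=> /andP[yc y1]; rewrite y1 ltW//; split => // ye; move: yc; rewrite ye ltxx.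
  by move=> [/andP[yc ->] /eqP ye]; rewrite lt_neqAle eq_sym ye yc.
rewrite Dl in dfl; rewrite Dr in dfr.
have fl : f y @[y --> within (`[0, c] `\ c) (nbhs c)] --> (1 : R).
  apply: cvg_trans fc1; apply: cvg_app => A cA.
  have {}cA : \forall y \near c, y < c -> A y by exact: cA.
  suff : \forall y \near c, (`[0, c] `\ c) y -> A y by [].
  apply: filterS cA => y + [+ /eqP ye]; rewrite /= in_itv /= => + /andP[_ yc]; apply.
  by rewrite lt_neqAle ye.
have fr : f y @[y --> within (`[c, 1] `\ c) (nbhs c)] --> (0 : R).
  apply: cvg_trans fc0; apply: cvg_app => A cA.
  have {}cA : \forall y \near c, y > c -> A y by exact: cA.
  suff : \forall y \near c, (`[c, 1] `\ c) y -> A y by [].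
  apply: filterS cA => y + [+ /eqP ye]; rewrite /= in_itv /= => + /andP[yc _]; apply.
  by rewrite lt_neqAle eq_sym ye.
have subl : `[0, c] `\ c `<=` `[0, 1] `\ c.
  by move=> y [+ yc]; rewrite /= !in_itv /= => /andP[-> /le_trans ->//]; exact: ltW.
have subr : `[c, 1] `\ c `<=` `[0, 1] `\ c.
  by move=> y [+ yc]; rewrite /= !in_itv /= => /andP[cy ->]; rewrite (le_trans (ltW c0)).
exists l; split.
- apply: le_lt_trans l2; rewrite -[leLHS]sqrtr1; exact: ler_wsqrtr (ler1n _ 2).
- rewrite -s2; apply: ltr_pM => //.
- by split; [exact: (extension_continuous dfl fl)|exact: (extension_continuous dfr fr)].
- move=> x y; apply: (extension_expands _ dfl _ fl); first by rewrite eqxx orbT.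
  by move=> z /subl/ldf.
- move=> x y; apply: (extension_expands _ dfr _ fr); first by rewrite eqxx.
  by move=> z /subr/ldf.
Qed.

Lemma lorenz_backward_orbit (R : realType) (c : R) (f : R -> R) n y :
  0 < c < 1 -> lorenz_map c f -> 0 < y < 1 ->
  exists x, [/\ 0 < x < 1, avoids c f n x & iter n f x = y].
Proof.
move=> c01 lf; have [l [l1 l2 [flc frc] flx frx]] := lorenz_map_expanding c01 lf.
by case: lf => _ [_ [_ _ f0 f1]]; exact: (expanding_backward_orbit c01 flc frc).
Qed.

Lemma lorenz_eventually_onto (R : realType) (c : R) (f : R -> R) u w y :
  0 < c < 1 -> lorenz_map c f -> 0 <= u -> u < w -> w <= 1 -> 0 < y < 1 ->
  reaches c f u w y.
Proof.
move=> c01 lf; have [l [l1 l2 [flc frc] flx frx]] := lorenz_map_expanding c01 lf.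
case: lf => _ [_ [_ _ f0 f1]].
exact: (expanding_eventually_onto c01 l1 l2 flc frc flx frx f0 f1).
Qed.

(** * Compactness and leaf contraction *)

(** The sets [K] intersected with [E n] generate a proper filter, which clusters in [K]. The [E n]
    are not closed, so the limit is only adherent to each; this replaces the extraction of
    convergent subsequences. *)
Lemma compact_nested_cluster (T : topologicalType) (K : set T) (E : nat -> set T) :
  compact K -> (forall m n, (m <= n)%N -> E n `<=` E m) ->
  (forall n, K `&` E n !=set0) ->
  exists2 a, K a & forall n B, nbhs a B -> E n `&` B !=set0.
Proof.
move=> cK dE E0.
pose F := filter_from [set: nat] (fun n => K `&` E n).
have FF : ProperFilter F.
  apply: filter_from_proper; last by move=> n _; exact: E0.
  apply: filter_from_filter; first by exists 0%N.
  move=> m n _ _; exists (maxn m n) => // a [Ka Ea].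
  by split; split => //; apply: dE Ea; rewrite ?leq_maxl ?leq_maxr.
have [|a [Ka aF]] := cK F FF; first by exists 0%N => // a [].
exists a => // n B aB.
have FE : F (K `&` E n) by exists n.
by have [b [[Kb Eb] Bb]] := aF _ _ FE aB; exists b.
Qed.

(** Heine's theorem: pairs violating it at the scales [1/(n+1)] would cluster at a point of the
    diagonal, where [h] is continuous. *)
Lemma compact_uniform_continuity (R : realType) (V W : normedModType R)
    (K : set V) (h : V -> W) (e : R) :
  compact K -> (forall a, K a -> {for a, continuous h}) -> 0 < e ->
  exists2 r : R, 0 < r & forall a b, K a -> K b -> `|a - b| < r -> `|h a - h b| < e.
Proof.
move=> cK ch e0; apply: contrapT => nr.
pose E n := [set p : V * V | `|p.1 - p.2| < n.+1%:R^-1 /\ ~ `|h p.1 - h p.2| < e].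
have [|m n mn p [/= pn pe]|n|[a b] [/= Ka Kb] abE] := @compact_nested_cluster _ (K `*` K) E.
- exact: compact_setX.
- by split => //=; apply: (lt_le_trans pn); rewrite lef_pV2 ?posrE// ler_nat.
- apply: contrapT => EK; apply: nr; exists n.+1%:R^-1; first by rewrite invr_gt0.
  move=> a b Ka Kb ab; apply: contrapT => hab; apply: EK.
  by exists (a, b).
have ab : a = b.
  apply/eqP; rewrite -subr_eq0 -normr_le0.
  suff abr (r : R) : 0 < r -> `|a - b| <= r.
    by apply/ler_addgt0Pr => r r0; rewrite add0r abr.
  move=> r0.
  have r3 : 0 < r / 3 by rewrite divr_gt0.
  have [n nr3] : exists n : nat, n.+1%:R^-1 < r / 3.
    by have [N _ /(_ N (leqnn N))] := near_infty_natSinv_lt (PosNum r3); exists N.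
  have : nbhs (a, b) (ball a (r / 3) `*` ball b (r / 3)).
    by exists (ball a (r / 3), ball b (r / 3)) => //; split; exact: nbhsx_ballx.
  move=> /(abE n)[[x y] [[/= xy _] [/= ax byy]]].
  rewrite -ball_normE /= in ax; rewrite -ball_normE /= in byy.
  have : `|a - b| <= `|a - x| + (`|x - y| + `|b - y|).
    rewrite [`|b - y|]distrC; apply: le_trans (ler_distD x a b) _.
    by rewrite lerD2l ler_distD.
  have {}ax : `|a - x| < r / 3 := ax.
  have {}byy : `|b - y| < r / 3 := byy.
  have {}xy : `|x - y| < r / 3 := lt_trans xy nr3.
  clear nr3 abE.
  by move: xy ax byy; lra.
subst b.
have e2 : 0 < e / 2 by rewrite divr_gt0.
have cha : h x @[x --> a] --> h a by exact: ch.
have /cvgrPdist_lt/(_ _ e2)/nbhs_ballP[r /= r0 hr] := cha.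
have : nbhs (a, a) (ball a r `*` ball a r).
  by exists (ball a r, ball a r) => //; split; exact: nbhsx_ballx.
move=> /(abE 0%N)[[x y] [[/= _ xy] [/= /hr ax /hr ay]]].
apply: xy; apply: le_lt_trans (ler_distD (h a) (h x) (h y)) _.
by rewrite distrC [e]splitr ltrD.
Qed.

Lemma fiber_contraction_lipschitz (R : realType) (c : R) (g : R -> R -> R) :
  c != 0 -> fiber_contraction c g ->
  exists2 mu : R, 0 <= mu < 1 & forall x y y', (`[0, 1] `\ c) x ->
    - 2^-1 <= y <= 2^-1 -> - 2^-1 <= y' <= 2^-1 ->
    `|g x y - g x y'| <= mu * `|y - y'|.
Proof.
move=> c0 [mu mu1 gP].
(* The derivative at one point, taken over the abscissa 0, already forces [mu] to be nonnegative. *)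
have [| |l0 _ lmu] := gP 0 0.
- by split; [rewrite /= in_itv /= lexx ler01|move/eqP; rewrite eq_sym (negbTE c0)].
- by apply/andP; split; lra.
exists mu => [|x]; first by rewrite mu1 andbT (le_trans _ lmu).
suff main : forall y y', (`[0, 1] `\ c) x ->
    - 2^-1 <= y -> y' <= 2^-1 -> y < y' -> `|g x y' - g x y| <= mu * `|y' - y|.
  move=> y y' Dx /andP[y1 y2] /andP[y1' y2'].
  have [yy'|yy'|->] := ltgtP y y'.
  - by rewrite distrC [`|y - _|]distrC; exact: main.
  - exact: main.
  - by rewrite !subrr normr0 mulr0.
move=> y y' Dx yl y'l yy'.
have /choice[dg dgP] : forall t, exists l, - 2^-1 <= t <= 2^-1 ->
    derivative_within `[- 2^-1, 2^-1] (g x) t l /\ `|l| <= mu.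
  move=> t; have [tI|] := boolP (- 2^-1 <= t <= 2^-1); last by exists 0.
  by have [l] := gP x t Dx tI; exists l.
have I t : y <= t <= y' -> - 2^-1 <= t <= 2^-1.
  by move=> /andP[yt ty']; rewrite (le_trans yl yt) (le_trans ty' y'l).
have [|||t tI ->] := @within_mvt _ `[- 2^-1, 2^-1] (g x) dg y y' yy'.
- by move=> t /=; rewrite !in_itv /= => /andP[yt ty']; apply: I; rewrite !ltW.
- apply/subspace_continuousP => t /=; rewrite in_itv /= => tI.
  apply: cvg_trans (derivative_within_continuous (dgP t (I t tI)).1).
  apply: cvg_app => A tA.
  have {}tA : \forall s \near t, s \in `[- 2^-1, 2^-1] -> A s by exact: tA.
  suff : \forall s \near t, s \in `[y, y'] -> A s by [].
  by apply: filterS tA => s + sI; apply; move: sI; rewrite !in_itv /= => /I.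
- by move=> t /andP[yt ty']; apply: (dgP t (I t _)).1; rewrite !ltW.
rewrite normrM ler_wpM2r//; apply: (dgP t (I t _)).2.
by case/andP: tI => ? ?; rewrite !ltW.
Qed.

(** * The core of the attractor *)

Section Core.
Variables (R : realType) (L : geometric_lorenz R).
Local Notation c := (gl_c L).
Local Notation f := (gl_f L).
Local Notation F := (gl_F L).
Local Notation sec := (gl_sec L).
Local Notation Phi := (gl_flow L).
Local Notation sigma := (gl_sing L).
Local Notation Lambda := (gl_attractor L).

Definition lorenz_core : set 'rV[R]_3 :=
  \bigcap_(n in [set: nat]) closure (sec @` iter_image c F n).

Lemma flow_core_attractor t p : lorenz_core p -> Lambda (Phi t p).
Proof. by move=> cp; apply: subset_closure; exists t => //; exists p. Qed.

Lemma squareP (x y : R) : square (x, y) <-> 0 <= x <= 1 /\ - 2^-1 <= y <= 2^-1 :> Prop.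
Proof. by rewrite /square /= !in_itv. Qed.

Lemma square_compact : compact (@square R).
Proof. by apply: compact_setX; exact: segment_compact. Qed.

Lemma sec_continuous p : square p -> {for p, continuous sec}.
Proof.
have [[B [_ sB dB]] _ _ _] := gl_secP L.
by move=> /sB/dB[/differentiable_continuous].
Qed.

Lemma flow_add s t p : Phi (s + t) p = Phi s (Phi t p).
Proof. by have [_ ->] := gl_flowP L. Qed.

Lemma flow_continuous t : continuous (Phi t).
Proof.
have [_ _ cP _] := gl_flowP L => p.
have tp : {for p, continuous (fun q : 'rV[R]_3 => (t, q))}.
  move=> B [[B1 B2] [/= tB1 pB2] sB]; apply: filterS pB2 => q qB.
  by apply: sB; split => //; exact: nbhs_singleton tB1.
exact: (continuous_comp tp (cP (t, p))).
Qed.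

Lemma off_segment p : square p -> p.1 <> c -> (square `\` segment c) p.
Proof. by move=> sp pc; split => // -[_]. Qed.

(** Consecutive return times add up to a single time of the flow. Closeness can then be carried
    along by [Phi], whose continuity is known, rather than by [F]. *)
Lemma return_iterates n p : square p -> avoids c f n p.1 ->
  [/\ square (iter n F p), (iter n F p).1 = iter n f p.1 &
      exists2 t, 0 <= t & Phi t (sec p) = sec (iter n F p)].
Proof.
move=> sp; elim: n => [_|n IH av].
  by split => //; exists 0 => //; have [->] := gl_flowP L.
have [|sq sq1 [t t0 tE]] := IH; first by move=> k kn; apply: av; rewrite ltnS ltnW.
have off : (square `\` segment c) (iter n F p).
  by apply: off_segment => //; rewrite sq1; exact: av.
have [sF [r [r0 _ _] rE]] := gl_returnP off.
split => //; first by rewrite !iterS -sq1.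
by exists (r + t); [rewrite addr_ge0// ltW|rewrite flow_add tE rE].
Qed.

Lemma iter_image_nested m n : (m <= n)%N ->
  iter_image c F n `<=` iter_image c F m.
Proof.
elim: n => [|n IH]; first by rewrite leqn0 => /eqP ->.
rewrite leq_eqVlt ltnS => /orP[/eqP -> //|/IH]; apply: subset_trans.
move=> _ [p [_ av] <-]; have [sF _] := gl_returnP (av 0%N isT).
by exists (F p); [split => // k kn|]; rewrite -iterSr//; exact: av.
Qed.

(** Each [x] has an [n]-fold preimage [u] avoiding [c], so [F^n(u, 0)] lies on the leaf over [x].
    These nested images cluster on the compact leaf, and [sec] sends the cluster point into all the
    closures. *)
Lemma core_fiber x : 0 < x < 1 -> exists2 y, square (x, y) & lorenz_core (sec (x, y)).
Proof.
move=> x01; pose I := `[- 2^-1, 2^-1]%classic : set R.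
have [|m n||a [/= a1 aI] aE] :=
  @compact_nested_cluster _ ([set x] `*` I) (iter_image c F).
- by apply: compact_setX; [exact: compact_set1|exact: segment_compact].
- exact: iter_image_nested.
- move=> n; have [u [u01 au ue]] := lorenz_backward_orbit n (gl_cP L) (gl_fP L) x01.
  have su : square (u, 0 : R).
    by apply/squareP; split; [case/andP: u01 => *; rewrite !ltW|rewrite oppr_le0 invr_ge0 ler0n].
  have [si s1 _] := return_iterates su au.
  exists (iter n F (u, 0)); split.
    by case: si => _ si; split => //=; rewrite s1.
  exists (u, 0) => //; split => // k kn.
  have [|sk k1 _] := @return_iterates k (u, 0) su.
    by move=> j jk; apply: au; exact: ltn_trans jk kn.
  by apply: off_segment => //; rewrite k1; exact: au.
have ax : a = (x, a.2) by rewrite -a1; case: a {a1 aI aE}.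
have sa : square (x, a.2) by apply/squareP; split; [case/andP: x01 => *; rewrite !ltW|].
exists a.2 => // n _; rewrite -ax => B aB.
have [b [Eb Bb]] := aE n _ (sec_continuous (eq_ind_r square sa ax) aB).
by exists (sec b); split => //; exists b.
Qed.

(** Points of one leaf keep a common first coordinate, so each return contracts by [mu]. The leaf
    has length 1, hence no extra constant. *)
Lemma leaf_contraction : exists2 mu : R, 0 <= mu < 1 &
  forall n x y y', square (x, y) -> square (x, y') -> avoids c f n x ->
    `|(iter n F (x, y)).2 - (iter n F (x, y')).2| <= mu ^+ n.
Proof.
have c0 : c != 0 by have /andP[/gt_eqF ->] := gl_cP L.
have [mu mu01 muP] := fiber_contraction_lipschitz c0 (gl_gP L).
exists mu => // n x y y' sy sy'; elim: n => [_|n IH av].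
  move: sy sy' => /squareP[_ /andP[? ?]] /squareP[_ /andP[? ?]].
  by rewrite expr0 ler_norml; apply/andP; split => /=; lra.
have av' : avoids c f n x by move=> k kn; apply: av; rewrite ltnS ltnW.
have [sq sq1 _] := return_iterates sy av'; have [sq' sq'1 _] := return_iterates sy' av'.
have xc := av n (ltnSn n).
rewrite !iterS exprS; move: sq sq' sq1 sq'1 (IH av').
case: (iter n F (x, y)) => a b; case: (iter n F (x, y')) => a' b' /=.
move=> /squareP[aI bI] /squareP[_ b'I] aE a'E ab; subst a a'.
have ax : (`[0, 1] `\ c) (iter n f x) by split => //=; rewrite in_itv.
apply: le_trans (muP _ _ _ ax bI b'I) _.
by apply: ler_wpM2l ab; case/andP: mu01.
Qed.

(** The core lies in the closure of the [n]-th image, so one point of some leaf returns near [p]; by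
    contraction the whole leaf follows it. *)
Lemma core_leaf_approximation p e : lorenz_core p -> 0 < e ->
  exists n x, [/\ (0 < n)%N, 0 <= x <= 1, avoids c f n x &
    forall y, square (x, y) -> `|sec (iter n F (x, y)) - p| < e].
Proof.
move=> cp e0; have e2 : 0 < e / 2 by rewrite divr_gt0.
have [r r0 rP] := compact_uniform_continuity square_compact sec_continuous e2.
have [mu mu01 muP] := leaf_contraction.
have [n nr] := small_power mu01 r0.
(* One iterate more than [nr] asks for makes the number of returns positive, which later gives
   [x <> c]. *)
have [|_ [[_ [[x y] [sxy av] <-] <-] pe]] := cp n.+1 I (ball p (e / 2)).
  exact: nbhsx_ballx.
have avx : avoids c f n.+1 x.
  elim: {-2}n.+1 (leqnn n.+1) => // m IH mn k; rewrite ltnS leq_eqVlt.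
  have avm := IH (ltnW mn).
  move=> /orP[/eqP ->|]; last exact: avm.
  have [_ <- _] := return_iterates sxy avm.
  by move=> mc; have [sm] := av m mn; apply; split.
exists n.+1, x; split => //; first by case/squareP : sxy.
move=> y' sxy'.
have [sq sq1 _] := return_iterates sxy avx; have [sq' sq'1 _] := return_iterates sxy' avx.
have : `|iter n.+1 F (x, y') - iter n.+1 F (x, y)| < r.
  rewrite prod_normE /= gt_max.
  move: sq1 sq'1; rewrite !iterS /= => -> ->; rewrite subrr normr0 r0 /=.
  have := muP n.+1 _ _ _ sxy' sxy avx; rewrite !iterS /= => /le_lt_trans; apply.
  apply: le_lt_trans nr; rewrite exprS ler_piMl ?exprn_ge0//; case/andP: mu01 => // _ /ltW//.
move=> /(rP _ _ sq' sq) close.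
rewrite -[_ - p](subrKA (sec (iter n.+1 F (x, y)))) (splitr e).
apply: le_lt_trans (ler_normD _ _) _; apply: ltrD => //.
by move: pe; rewrite -ball_normE /= distrC.
Qed.

End Core.

(** * Chains to and from the singularity *)

Section Chains.
Variables (R : realType) (L : geometric_lorenz R).
Local Notation c := (gl_c L).
Local Notation f := (gl_f L).
Local Notation F := (gl_F L).
Local Notation sec := (gl_sec L).
Local Notation Phi := (gl_flow L).
Local Notation sigma := (gl_sing L).
Local Notation Lambda := (gl_attractor L).

Lemma Gamma_to_sing p e : gl_Gamma L p -> 0 < e ->
  exists M, forall t, M < t -> `|Phi t p - sigma| < e.
Proof.
move=> Gp e0; have [W _ WE] := gl_stableP L.
have [_ [_ /cvgrPdist_lt/(_ e e0)[M [_ MP]]]] : (gl_S L `&` local_stable_set Phi W sigma) p.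
  by rewrite WE.
by exists M => t /MP; rewrite distrC.
Qed.

Lemma segment_Gamma p : square p -> p.1 = c -> gl_Gamma L (sec p).
Proof. by move=> sp pc; exists p. Qed.

Lemma core_Gamma : exists2 y, square (c, y) & lorenz_core L (sec (c, y)).
Proof. exact: core_fiber (gl_cP L). Qed.

Lemma flow_near t p e : 0 < e ->
  exists2 r : R, 0 < r & forall q, `|q - p| < r -> `|Phi t q - Phi t p| < e.
Proof.
move=> e0; have /cvgrPdist_lt/(_ e e0)/nbhs_ballP[r r0 rP] : Phi t x @[x --> p] --> Phi t p.
  exact: flow_continuous.
by exists r => // q qp; rewrite distrC; apply: rP; rewrite -ball_normE /= distrC.
Qed.

(** The orbit of a point of [gl_Gamma] converges to the singularity, and the limit of an orbit is
    fixed by a continuous flow. *)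
Lemma sing_fixed t : Phi t sigma = sigma.
Proof.
apply/eqP; rewrite -subr_eq0 -normr_le0.
suff te (e : R) : 0 < e -> `|Phi t sigma - sigma| <= e.
  by apply/ler_addgt0Pr => e e0; rewrite add0r te.
move=> e0; have e2 : 0 < e / 2 by rewrite divr_gt0.
have [y sy _] := core_Gamma; have Gy := segment_Gamma sy erefl.
have [r r0 rP] := flow_near t sigma e2.
have [M1 M1P] := Gamma_to_sing Gy r0; have [M2 M2P] := Gamma_to_sing Gy e2.
pose s := Num.max M1 (M2 - t) + 1.
have s1 : M1 < s by rewrite ltr_pwDr// le_max lexx.
have s2 : M2 < t + s by rewrite -ltrBlDl ltr_pwDr// le_max lexx orbT.
have := rP _ (M1P s s1); rewrite -flow_add => d1; have d2 := M2P _ s2.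
rewrite -(subrKA (Phi (t + s) (sec (c, y)))); apply: le_trans (ler_normD _ _) _.
by rewrite [e]splitr lerD ?(ltW d2)// distrC ltW.
Qed.

Lemma attractor_approximation u e : Lambda u -> 0 < e ->
  exists r p, lorenz_core L p /\ `|Phi r p - u| < e.
Proof.
move=> Lu e0; have [|_ [[r _ [p cp <-]] up]] := Lu (ball u e); first exact: nbhsx_ballx.
by exists r, p; split => //; move: up; rewrite -ball_normE /= distrC.
Qed.

Lemma attractor_closed u :
  (forall e, 0 < e -> exists w, Lambda w /\ `|w - u| < e) -> Lambda u.
Proof.
move=> H; apply: closed_closure => B /nbhs_ballP[e e0 eB].
have [w [Lw wu]] := H e e0; exists w; split => //; apply: eB.
by rewrite -ball_normE /= distrC.
Qed.

Lemma sing_attractor : Lambda sigma.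
Proof.
have [y sy cy] := core_Gamma; have Gy := segment_Gamma sy erefl.
apply: attractor_closed => e e0; have [M MP] := Gamma_to_sing Gy e0.
exists (Phi (M + 1) (sec (c, y))); split; first exact: flow_core_attractor.
by apply: MP; rewrite ltrDl.
Qed.

(** The field vanishes at the singularity, whereas transversality, tested on the zero tangent
    vector, forbids this on the section. *)
Lemma sec_neq_sing p : square p -> sec p <> sigma.
Proof.
move=> sp E; have [_ _ _ /(_ p sp 0)] := gl_secP L; apply.
by rewrite E; have [-> _] := gl_singP L; rewrite linear0.
Qed.

Lemma reaches_near x y e : 0 <= x <= 1 -> 0 < e -> 0 < y < 1 ->
  exists n z, [/\ 0 < z < 1, `|z - x| < e, avoids c f n z & iter n f z = y].
Proof.
move=> /andP[x0 x1] e0 y01.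
pose u := Num.max 0 (x - e); pose w := Num.min 1 (x + e).
have u0 : 0 <= u by rewrite le_max lexx.
have w1 : w <= 1 by rewrite ge_min lexx.
have uw : u < w by rewrite lt_min !gt_max; do ?(apply/andP; split); lra.
have [n [z [/andP[uz zw] az ez]]] := lorenz_eventually_onto (gl_cP L) (gl_fP L) u0 uw w1 y01.
exists n, z; split => //.
  by rewrite (le_lt_trans u0 uz) (lt_le_trans zw w1).
move: uz zw; rewrite gt_max lt_min => /andP[_ uz] /andP[_ zw].
by rewrite ltr_norml; apply/andP; split; lra.
Qed.

Lemma cluster_value (T : topologicalType) (E : nat -> set T) (a : T) (h : T -> R) x :
  {for a, continuous h} -> (forall n B, nbhs a B -> E n `&` B !=set0) ->
  (forall n b, E n b -> `|h b - x| < n.+1%:R^-1) -> h a = x.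
Proof.
move=> ch aE hE; apply/eqP; rewrite -subr_eq0 -normr_le0.
suff he (e : R) : 0 < e -> `|h a - x| <= e.
  by apply/ler_addgt0Pr => e e0; rewrite add0r he.
move=> e0; have e2 : 0 < e / 2 by rewrite divr_gt0.
have [N _ /(_ N (leqnn N)) Ne] := near_infty_natSinv_lt (PosNum e2).
have /cvgrPdist_lt/(_ _ e2) he : h y @[y --> a] --> h a by exact: ch.
have [b [/hE Eb hb]] := aE N _ he.
rewrite -(subrKA (h b)); apply: le_trans (ler_normD _ _) _.
by rewrite [e]splitr lerD// ltW// (lt_trans Eb).
Qed.

(** Take [x] whose leaf returns near [p], with [Phi r p] near [u]. Core points over preimages of [c]
    close to [x] cluster at a point [a] over [x] itself, whose orbit passes near [u]. Those close to
    [a] do so too, and they reach the stable segment. *)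
Lemma attractor_to_sing u e : Lambda u -> 0 < e ->
  exists w, [/\ Lambda w, `|w - u| < e &
    forall d, 0 < d -> exists M, forall t, M < t -> `|Phi t w - sigma| < d].
Proof.
move=> Lu e0; have e3 : 0 < e / 3 by rewrite divr_gt0.
have [r [p [cp pu]]] := attractor_approximation Lu e3.
have [d d0 dP] := flow_near r p e3.
have [n [x [_ x01 avx xP]]] := core_leaf_approximation cp d0.
pose E k := [set a : R * R | [/\ square a /\ lorenz_core L (sec a), `|a.1 - x| < k.+1%:R^-1 &
  exists2 N, avoids c f N a.1 & iter N f a.1 = c]].
have [m k mk a [[sa Ea] ax aN]|k|a sa aE] := @compact_nested_cluster _ _ E (@square_compact R).
- by split => //; apply: lt_le_trans ax _; rewrite lef_pV2 ?posrE// ler_nat.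
- have [|N [z [z01 zx az ez]]] := reaches_near x01 (_ : 0 < k.+1%:R^-1) (gl_cP L).
    by rewrite invr_gt0.
  have [y sy cy] := core_fiber L z01.
  by exists (z, y); split => //; split => //; exists N.
have ax : a.1 = x.
  by apply: cluster_value aE _; [exact: cvg_fst|move=> k b []].
have aE' : a = (x, a.2) by rewrite -ax; case: (a).
have av : avoids c f n a.1 by rewrite ax.
have [_ _ [t t0 tE]] := return_iterates sa av.
have [q q0 qP] := flow_near (r + t) (sec a) e3.
have /cvgrPdist_lt/(_ _ q0) near_a : sec b @[b --> a] --> sec a by exact: sec_continuous.
have [b [[[sb cb] _ [N avb bN]] ab]] := aE 0%N _ near_a.
exists (Phi (r + t) (sec b)); split; first exact: flow_core_attractor.
  have d1 : `|Phi (r + t) (sec b) - Phi (r + t) (sec a)| < e / 3.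
    by apply: qP; rewrite distrC.
  have d2 : `|Phi (r + t) (sec a) - Phi r p| < e / 3.
    by rewrite flow_add tE; apply: dP; rewrite aE'; apply: xP; rewrite -aE'.
  rewrite -(subrKA (Phi (r + t) (sec a))) -[_ - u](subrKA (Phi r p)).
  apply: le_lt_trans (ler_normD _ _) _.
  have : `|Phi (r + t) (sec a) - Phi r p + (Phi r p - u)| < e / 3 + e / 3.
    by apply: le_lt_trans (ler_normD _ _) _; exact: ltrD.
  by move: d1; lra.
move=> h h0.
have [sbN bN1 [T T0 TE]] := return_iterates sb avb.
have [M MP] := Gamma_to_sing (segment_Gamma sbN (etrans bN1 bN)) h0.
(* Time [s] counted from the new point is time [s + (r + t) - T] counted from the hit on the stable
   segment. *)
exists (M - (r + t) + T) => s sM.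
have -> : Phi s (Phi (r + t) (sec b)) = Phi (s + (r + t) - T) (sec (iter N F b)).
  by rewrite -TE -!flow_add subrK.
by apply: MP; move: sM; lra.
Qed.


Lemma flow_jointly_continuous t p :
  {for (t, p), continuous (fun tp : R * 'rV[R]_3 => Phi tp.1 tp.2)}.
Proof. by have [_ _ cP _] := gl_flowP L; exact: cP. Qed.

(* A bounded travel time would pass to the limit and bring a point of [Gamma]
   back to the section. *)
Lemma travel_time_unbounded x M : x <> c -> exists k : nat, forall a q T,
  square a -> square q -> `|a.1 - c| < k.+1%:R^-1 -> `|q.1 - x| < k.+1%:R^-1 ->
  0 <= T -> Phi T (sec a) = sec q -> M < T.
Proof.
move=> xc; apply: contrapT => nk.
pose I := `[0, M]%classic : set R.
pose E k := [set z : (R * R) * (R * R) * R | [/\ `|z.1.1.1 - c| < k.+1%:R^-1,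
  `|z.1.2.1 - x| < k.+1%:R^-1 & Phi z.2 (sec z.1.1) = sec z.1.2]].
have [|m k mk z [z1 z2 z3]|k|[[a q] T] [[/= sa sq] TI] zE] :=
    @compact_nested_cluster _ ((@square R `*` @square R) `*` I) E.
- apply: compact_setX; last exact: segment_compact.
  by apply: compact_setX; exact: square_compact.
- have km : k.+1%:R^-1 <= m.+1%:R^-1 :> R by rewrite lef_pV2 ?posrE// ler_nat.
  by split => //; [exact: lt_le_trans z1 km|exact: lt_le_trans z2 km].
- apply: contrapT => nE; apply: nk; exists k => a q T sa sq ac qx T0 TE.
  rewrite ltNge; apply/negP => TM; apply: nE.
  exists (a, q, T); split; last by split.
  by split => //; rewrite /I /= in_itv /= T0.
have ca : {for (a, q, T), continuous (fun z : (R * R) * (R * R) * R => z.1.1)}.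
  exact: (cvg_comp _ _ cvg_fst cvg_fst).
have cq : {for (a, q, T), continuous (fun z : (R * R) * (R * R) * R => z.1.2)}.
  exact: (cvg_comp _ _ cvg_fst cvg_snd).
have cT : {for (a, q, T), continuous (fun z : (R * R) * (R * R) * R => z.2)}.
  exact: cvg_snd.
have ac : a.1 = c.
  by apply: (cluster_value (h := fun z => z.1.1.1)) zE _;
    [exact: (cvg_comp _ _ ca cvg_fst)|move=> k z []].
have qx : q.1 = x.
  by apply: (cluster_value (h := fun z => z.1.2.1)) zE _;
    [exact: (cvg_comp _ _ cq cvg_fst)|move=> k z []].
have aT : {for (a, q, T), continuous (fun z : (R * R) * (R * R) * R => (z.2, sec z.1.1))}.
  have csa := continuous_comp ca (@sec_continuous R L a sa).
  move=> B [[B1 B2] [/= B1T B2a] sB].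
  have near1 : \forall z \near (a, q, T), B1 z.2 by exact: (cT B1 B1T).
  have near2 : \forall z \near (a, q, T), B2 (sec z.1.1) by exact: (csa B2 B2a).
  suff : \forall z \near (a, q, T), B (z.2, sec z.1.1) by [].
  apply: (filterS _ (filterI near1 near2)) => z [Bz1 Bz2].
  exact: sB.
have PE : `|Phi T (sec a) - sec q| = 0.
  apply: (cluster_value (h := fun z => `|Phi z.2 (sec z.1.1) - sec z.1.2|)) zE _.
    apply: cvg_norm; apply: cvgB.
      exact: (continuous_comp aT (@flow_jointly_continuous T (sec a))).
    exact: (continuous_comp cq (@sec_continuous R L q sq)).
  by move=> k z [_ _ ->]; rewrite subrr normr0 subrr normr0 invr_gt0.
move/eqP: PE; rewrite normr_eq0 subr_eq0 => /eqP PE.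
(* A limit time 0 is treated apart: injectivity of [sec] then gives [a = q], a point over both [c]
   and [x]. *)
move: TI; rewrite /I /= in_itv /= => /andP[+ _]; rewrite le_eqVlt => /orP[/eqP T0|T0].
  have [_ inj _ _] := gl_secP L.
  have aq : a = q.
    apply: inj; rewrite ?inE// -PE -T0.
    by have [->] := gl_flowP L.
  by apply: xc; rewrite -qx -aq ac.
apply: (gl_GammaP (segment_Gamma sa ac) T0); rewrite PE.
by exists q.
Qed.

Lemma interior_near x e : 0 <= x <= 1 -> 0 < e ->
  exists2 z : R, 0 < z < 1 & `|z - x| < e.
Proof.
move=> x01 e0; have [n [z [z01 zx _ _]]] := reaches_near x01 e0 (gl_cP L).
by exists z.
Qed.

(** Core points over points near [c] that [f] iterates to near [x], paired with their returns,
    cluster at some [(a, q)] over [(c, x)]. The orbit of [a] tends to the singularity and that of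
    [q] passes near [v]; by continuity of the flow a nearby orbit does both. *)
Lemma sing_to_attractor v e : Lambda v -> 0 < e ->
  exists w t, [/\ Lambda w, `|w - sigma| < e, 1 <= t & `|Phi t w - v| < e].
Proof.
move=> Lv e0; have e2 : 0 < e / 2 by rewrite divr_gt0.
have e3 : 0 < e / 3 by rewrite divr_gt0.
have [r [p [cp pv]]] := attractor_approximation Lv e3.
have [d d0 dP] := flow_near r p e3.
have [n [x [n0 x01 avx xP]]] := core_leaf_approximation cp d0.
have xc : x <> c by exact: avx n0.
have c01 : 0 <= c <= 1 by have /andP[? ?] := gl_cP L; rewrite !ltW.
pose E k := [set z : (R * R) * (R * R) | [/\ square z.1 /\ square z.2,
  lorenz_core L (sec z.1), `|z.1.1 - c| < k.+1%:R^-1, `|z.2.1 - x| < k.+1%:R^-1 &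
  exists2 T, 0 <= T & Phi T (sec z.1) = sec z.2]].
have dE m k : (m <= k)%N -> E k `<=` E m.
  move=> mk z [z1 z2 z3 z4 z5].
  have km : k.+1%:R^-1 <= m.+1%:R^-1 :> R by rewrite lef_pV2 ?posrE// ler_nat.
  by split => //; [exact: lt_le_trans z3 km|exact: lt_le_trans z4 km].
have [||k|[a q] [/= sa sq] zE] :=
    @compact_nested_cluster _ (@square R `*` @square R) E.
- by apply: compact_setX; exact: square_compact.
- exact: dE.
- have k0 : 0 < k.+1%:R^-1 :> R by rewrite invr_gt0.
  have [y y01 yx] := interior_near x01 k0.
  have [N [z [z01 zc az ez]]] := reaches_near c01 k0 y01.
  have [y' sz cz] := core_fiber L z01.
  have [sN N1 NT] := return_iterates sz az.
  by exists ((z, y'), iter N F (z, y')); split; split => //=; rewrite N1 /= ez.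
have ca : {for (a, q), continuous (fun z : (R * R) * (R * R) => z.1)} by exact: cvg_fst.
have cq : {for (a, q), continuous (fun z : (R * R) * (R * R) => z.2)} by exact: cvg_snd.
have ac : a.1 = c.
  by apply: (cluster_value (h := fun z => z.1.1)) zE _;
    [exact: (cvg_comp _ _ ca cvg_fst)|move=> k z []].
have qx : q.1 = x.
  by apply: (cluster_value (h := fun z => z.2.1)) zE _;
    [exact: (cvg_comp _ _ cq cvg_fst)|move=> k z []].
have [S0 S0P] := Gamma_to_sing (segment_Gamma sa ac) e2.
have qE : q = (x, q.2) by rewrite -qx; case: (q).
have avq : avoids c f n q.1 by rewrite qx.
have [_ _ [t t0 tE]] := return_iterates sq avq.
pose S1 := S0 + 1.
(* The bound makes the remaining time [T - S1 + (r + t)] at least 1, even though [r] may be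
   negative. *)
have [k kP] := @travel_time_unbounded x (1 + S1 - r - t) xc.
have [d1 d10 d1P] := flow_near S1 (sec a) e2.
have [d2 d20 d2P] := flow_near (r + t) (sec q) e3.
have /cvgrPdist_lt/(_ _ d10) near_a : sec z.1 @[z --> (a, q)] --> sec a.
  exact: (continuous_comp ca (@sec_continuous R L a sa)).
have /cvgrPdist_lt/(_ _ d20) near_q : sec z.2 @[z --> (a, q)] --> sec q.
  exact: continuous_comp cq (@sec_continuous R L q sq).
have [[a' q'] [[/= [sa' sq'] ca' ac' qx' [T T0 TE]] [aa' qq']]] :=
  zE k _ (filterI near_a near_q).
have MT := kP _ _ _ sa' sq' ac' qx' T0 TE.
exists (Phi S1 (sec a')), (T - S1 + (r + t)); split.
- exact: flow_core_attractor.
- rewrite -(subrKA (Phi S1 (sec a))) [e]splitr; apply: le_lt_trans (ler_normD _ _) _.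
  apply: ltrD; first by apply: d1P; rewrite distrC.
  by apply: S0P; rewrite ltrDl.
- by clear - MT; lra.
have -> : Phi (T - S1 + (r + t)) (Phi S1 (sec a')) = Phi (r + t) (sec q').
  by rewrite -TE -!flow_add; congr (Phi _ _); lra.
have h1 : `|Phi (r + t) (sec q') - Phi (r + t) (sec q)| < e / 3.
  by apply: d2P; rewrite distrC.
have h2 : `|Phi (r + t) (sec q) - Phi r p| < e / 3.
  by rewrite flow_add tE; apply: dP; rewrite qE; apply: xP; rewrite -qE.
rewrite -(subrKA (Phi (r + t) (sec q))) -[_ - v](subrKA (Phi r p)).
apply: le_lt_trans (ler_normD _ _) _.
have h3 : `|Phi (r + t) (sec q) - Phi r p + (Phi r p - v)| < e / 3 + e / 3.
  by apply: le_lt_trans (ler_normD _ _) _; exact: ltrD.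
by clear - h1 h3; lra.
Qed.

End Chains.

(** * Backward orbits near the singularity *)

Lemma coord_le_norm (R : realType) n (v : 'rV[R]_n) j : `|v 0 j| <= `|v|.
Proof.
rewrite /Num.Def.normr /= mx_normrE.
exact: (le_bigmax _ (fun ij : 'I_1 * 'I_n => `|v ij.1 ij.2|) (0, j)).
Qed.

Lemma is_derive_coord (R : realType) n (u : R -> 'rV[R]_n) t v j :
  is_derive t (1 : R) u v -> is_derive t (1 : R) (fun s => u s 0 j) (v 0 j).
Proof.
move=> [du uv].
suff hl : e^-1 *: (((fun s => u s 0 j) \o shift t) (e *: 1) - u t 0 j)
    @[e --> (0 : R)^'] --> v 0 j.
  by split; [apply/cvg_ex; exists (v 0 j)|exact/cvg_lim].
have hv : e^-1 *: ((u \o shift t) (e *: 1) - u t) @[e --> (0 : R)^'] --> v.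
  by rewrite -uv; exact: du.
have := cvg_comp _ _ hv (@coord_continuous _ _ _ 0 j v).
by apply: cvg_trans; apply: near_eq_cvg; apply: nearW => e /=; rewrite !mxE.
Qed.

Lemma is_derive_diff_comp (R : realType) (V W : normedModType R)
    (u : R -> V) (k : V -> W) t v :
  is_derive t (1 : R) u v -> differentiable k (u t) ->
  is_derive t (1 : R) (k \o u) ('d k (u t) v).
Proof.
move=> [/derivable1_diffP du uv] dk.
have dku : differentiable (k \o u) t by exact: differentiable_comp.
split; first exact: diff_derivable.
by rewrite deriveE// diff_comp//= -uv deriveE.
Qed.

(** Integrating factor: [expR (- l * t) * phi t] has zero derivative for [t <= 0]. *)
Lemma backward_exponential (R : realType) (phi : R -> R) (l : R) :
  (forall t : R, t <= 0 -> is_derive t (1 : R) phi (l * phi t)) ->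
  forall t : R, t <= 0 -> phi t = expR (l * t) * phi 0.
Proof.
move=> dphi t t0.
pose h (s : R) := expR (- l * s) * phi s.
have dh (s : R) : s <= 0 -> is_derive s (1 : R) h 0.
  move=> s0; have d1 : is_derive s (1 : R) (fun r : R => - l * r) (- l).
    have -> : (fun r : R => - l * r) = (- l) \*: (id : R -> R) by [].
    by apply: is_derive_eq; rewrite [_ *: _]mulr1.
  have d2 : is_derive s (1 : R) (expR \o (fun r : R => - l * r)) (expR (- l * s) * - l).
    exact: is_derive1_comp.
  have d3 := is_deriveM d2 (dphi s s0).
  apply: (@is_derive_eq _ _ _ _ _ _ _ _ d3).
  rewrite -[LHS]/(expR (- l * s) * (l * phi s) + phi s * (expR (- l * s) * - l)).
  by lra.
have ht : h 0 = h t.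
  move: t0; rewrite le_eqVlt => /orP[/eqP -> //|t0].
  have [||s _ E] := @MVT R h (fun=> 0) t 0 t0.
  - by move=> s; rewrite in_itv /= => /andP[_ /ltW/dh].
  - apply: derivable_within_continuous => s; rewrite in_itv /= => /andP[_ /dh ds].
    exact: ex_derive.
  by apply/eqP; rewrite -subr_eq0 E mul0r.
move: ht; rewrite /h mulr0 expR0 mul1r => ->.
by rewrite mulrA -expRD mulNr addrN expR0 mul1r.
Qed.

Lemma backward_bounded_decay (R : realType) (phi : R -> R) (l : R) :
  l < 0 -> (forall t : R, t <= 0 -> is_derive t (1 : R) phi (l * phi t)) ->
  (forall t : R, t <= 0 -> `|phi t| <= 1) -> phi 0 = 0.
Proof.
move=> l0 dphi phi1; apply/eqP; apply: contrapT => /negP phi0.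
have a0 : 0 < `|phi 0| by rewrite normr_gt0.
pose t := `|phi 0|^-1 / l.
have t0 : t <= 0 by rewrite mulr_ge0_le0 ?invr_ge0// invr_le0 ltW.
have := phi1 t t0; rewrite (backward_exponential dphi t0) normrM.
have -> : l * t = `|phi 0|^-1 by rewrite /t mulrC divfK// lt_eqF.
rewrite ger0_norm ?expR_ge0// leNgt => /negP; apply.
rewrite -ltr_pdivrMr// mul1r (lt_le_trans _ (expR_ge1Dx _))//.
by rewrite ltrDr.
Qed.

Section UnstableManifold.
Variables (R : realType) (L : geometric_lorenz R).
Local Notation Phi := (gl_flow L).
Local Notation sigma := (gl_sing L).

Definition backward_near (e : R) (y : 'rV[R]_3) :=
  forall t, t <= 0 -> `|Phi t y - sigma| <= e.

(* In the linearizing coordinates a backward orbit staying near [sigma] lies on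
   the expanding axis, each half of which is a single orbit; [s] is the
   coordinate on this axis. *)
Lemma backward_near_sing : exists2 e0 : R, 0 < e0 & exists s : 'rV[R]_3 -> R,
  (forall y, backward_near e0 y -> s y = 0 -> y = sigma) /\
  (forall y y', backward_near e0 y -> backward_near e0 y' -> 0 < s y * s y' ->
     exists t, y' = Phi t y).
Proof.
have [_ [l1 [l2 [l3 [U [k [[l30 l31 l12] [oU Us] [kC ks] [kinj _] kV]]]]]]] := gl_singP L.
have dk p : U p -> differentiable k p by move=> /kC[].
have near_U : \forall p \near sigma, U p /\ `|k p| < 1.
  apply: filterI; first exact: open_nbhs_nbhs.
  have /differentiable_continuous ck := dk _ Us.
  have /cvgrPdist_lt/(_ 1 ltr01) : k p @[p --> sigma] --> k sigma by exact: ck.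
  by apply: filterS => p; rewrite ks sub0r normrN.
have /nbhs_ballP[r /= r0 rU] := near_U.
have r2 : r / 2 < r by lra.
(* [backward_near] uses a closed ball; half the radius keeps it inside the open ball where [k] is
   controlled. *)
exists (r / 2); first by rewrite divr_gt0.
have bU y (t : R) : backward_near (r / 2) y -> t <= 0 -> U (Phi t y) /\ `|k (Phi t y)| < 1.
  by move=> by_ t0; apply: rU; rewrite -ball_normE /= distrC (le_lt_trans (by_ t t0)).
pose l (j : 'I_3) : R := [:: l1; - l2; - l3]`_j.
have dphi y j (t : R) : backward_near (r / 2) y -> t <= 0 ->
    is_derive t (1 : R) (fun s => k (Phi s y) 0 j) (l j * k (Phi t y) 0 j).
  move=> by_ t0; have [Ut _] := bU y t by_ t0.
  have [_ _ _ /(_ y t) du] := gl_flowP L.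
  have := is_derive_coord j (is_derive_diff_comp du (dk _ Ut)).
  by rewrite kV// mxE.
have Phi0 y : Phi 0 y = y by have [->] := gl_flowP L.
have U0 y : backward_near (r / 2) y -> U y.
  by move=> by_; have [] := bU y 0 by_ (lexx _); rewrite Phi0.
(* The two contracting directions blow up in backward time, so a bounded backward orbit has zero
   coordinates there. *)
have kE y : backward_near (r / 2) y -> forall j : 'I_3, j != 0 -> k y 0 j = 0.
  move=> by_ j j0; rewrite -[in LHS](Phi0 y).
  apply: (@backward_bounded_decay _ (fun t => k (Phi t y) 0 j) (l j)).
  - by move: j j0 => [[|[|[|//]]]] //= i _; rewrite /l /= oppr_lt0; lra.
  - by move=> t; exact: dphi.
  - move=> t t0; apply: le_trans (coord_le_norm _ _) _.
    by apply: ltW; have [] := bU y t by_ t0.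
exists (fun y => k y 0 0); split.
  move=> y by_ s0; apply: kinj; rewrite ?inE//; first exact: U0.
  apply/rowP => j; rewrite ks mxE; have [->//|j0] := eqVneq j 0; exact: kE.
(* By symmetry [y'] may be taken closer to the singularity. It is then reached from [y] at a time
   [t <= 0], where the exponential formula is available: [expR (l1 * t)] has to be the ratio
   [q <= 1]. *)
suff half y y' : backward_near (r / 2) y -> backward_near (r / 2) y' ->
    0 < k y 0 0 * k y' 0 0 -> `|k y' 0 0| <= `|k y 0 0| -> exists t, y' = Phi t y.
  move=> y y' by_ by' yy'; have [le|/ltW le] := leP `|k y' 0 0| `|k y 0 0|.
    exact: half.
  have [|t ->] := half y' y by' by_ _ le; first by rewrite mulrC.
  by exists (- t); have [P0 PD _ _] := gl_flowP L; rewrite -PD addNr P0.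
move=> by_ by' yy' le.
have y0 : k y 0 0 != 0 by apply: contraTneq yy' => ->; rewrite mul0r ltxx.
have y'0 : k y' 0 0 != 0 by apply: contraTneq yy' => ->; rewrite mulr0 ltxx.
pose q := k y' 0 0 / k y 0 0.
have y2 : 0 < k y 0 0 * k y 0 0 by rewrite -expr2 exprn_even_gt0.
have q0 : 0 < q.
  by rewrite -(pmulr_rgt0 q y2) -mulrA [k y 0 0 * q]mulrC /q divfK.
have q1 : q <= 1.
  by rewrite -(gtr0_norm q0) normrM normfV ler_pdivrMr ?normr_gt0// mul1r.
have l10 : 0 < l1 by lra.
pose t := ln q / l1.
have t0 : t <= 0 by rewrite mulr_le0_ge0 ?ln_le0// invr_ge0 ltW.
have bt : backward_near (r / 2) (Phi t y).
  move=> s s0; have [_ PD _ _] := gl_flowP L.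
  by rewrite -PD; apply: by_; lra.
exists t; apply: kinj; rewrite ?inE; [exact: U0|exact: U0|].
apply/rowP => j; have [->|j0] := eqVneq j 0; last by rewrite !kE.
rewrite (@backward_exponential _ (fun t => k (Phi t y) 0 0) l1 _ t t0) ?Phi0.
  have -> : l1 * t = ln q by rewrite /t mulrC divfK// gt_eqF.
  by rewrite lnK ?posrE// /q divfK.
by move=> s s0; have := dphi y 0 s by_ s0.
Qed.

End UnstableManifold.

(** * Shadowing of loops *)

Section EuclideanDistance.
Variable R : realType.

Lemma norm_le_euclidean (p q : 'rV[R]_3) : `|p - q| <= euclidean_dist p q.
Proof.
have s0 : 0 <= euclidean_dist p q by exact: sqrtr_ge0.
rewrite {1}/Num.Def.normr /= mx_normrE.
apply/bigmax_leP; split => // -[i j] _ /=; rewrite ord1 !mxE.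
rewrite -sqrtr_sqr ler_wsqrtr// (bigD1 j)//= lerDl sumr_ge0// => k _.
exact: sqr_ge0.
Qed.

(** The factor 2 is a convenient bound for the square root of 3. *)
Lemma euclidean_le_norm (p q : 'rV[R]_3) : euclidean_dist p q <= 2 * `|p - q|.
Proof.
have n0 : 0 <= 2 * `|p - q| by rewrite mulr_ge0.
rewrite -[leRHS](ger0_norm n0) -sqrtr_sqr ler_wsqrtr// exprMn.
have coord i : (p 0 i - q 0 i) ^+ 2 <= `|p - q| ^+ 2.
  rewrite -[leLHS]real_normK ?num_real// lerXn2r ?nnegrE//.
  by have := coord_le_norm (p - q) i; rewrite !mxE.
rewrite !big_ord_recl big_ord0 /= addr0.
have := coord ord0; have := coord (lift ord0 ord0); have := coord (lift ord0 (lift ord0 ord0)).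
have : 0 <= `|p - q| ^+ 2 by exact: sqr_ge0.
have -> : 2 ^+ 2 = 4 :> R by rewrite -natrX.
lra.
Qed.

Lemma euclidean_lt (p q : 'rV[R]_3) e : `|p - q| < e / 2 -> euclidean_dist p q <= e.
Proof. by move=> pq; apply: le_trans (euclidean_le_norm p q) _; move: pq; lra. Qed.

End EuclideanDistance.

(** * Locating a time between consecutive jumps of a pseudo-orbit *)

Section SwitchTimes.
Variable R : realType.

Lemma NegzS1 (n : nat) : Negz n.+1 + 1 = Negz n.
Proof. by rewrite !NegzE -[n.+2]addn1 PoszD opprD addrNK. Qed.

Lemma switch_timeS (t : int -> R) (i : int) :
  switch_time t (i + 1) = switch_time t i + t i.
Proof.
case: i => [n|[|n]].
- have -> : Posz n + 1 = n.+1 by rewrite -addn1.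
  by rewrite /= big_ord_recr.
- by rewrite /= big_ord_recr !big_ord0 /= add0r addNr.
- by rewrite NegzS1 /= [in RHS]big_ord_recr /= opprD subrK.
Qed.

Variable t : int -> R.
Hypothesis t1 : forall i, 1 <= t i.

Lemma switch_time_increasing (m n : nat) :
  (m < n)%N -> switch_time t (Posz m) < switch_time t (Posz n).
Proof.
move=> mn; have step k : switch_time t (Posz k) < switch_time t (Posz k.+1).
  have -> : Posz k.+1 = Posz k + 1 by rewrite -addn1.
  by rewrite switch_timeS ltrDl (lt_le_trans ltr01).
elim: n mn => // n IH; rewrite ltnS leq_eqVlt => /orP[/eqP ->|/IH/lt_trans]; [|apply];
  exact: step.
Qed.

(** Each leg lasts at least 1, so the switching times grow at least linearly and exceed [u]. *)
Lemma forward_switch (m : nat) u : switch_time t m <= u ->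
  exists2 i : nat, (m <= i)%N & switch_time t i <= u < switch_time t (Posz i + 1).
Proof.
move=> mu.
have grow k : switch_time t m + k%:R <= switch_time t (m + k)%N.
  elim: k => [|k IH]; first by rewrite addr0 addn0.
  have -> : Posz (m + k.+1)%N = Posz (m + k)%N + 1 by rewrite addnS -addn1.
  by rewrite switch_timeS -natr1 addrA lerD.
have [k ku] : exists k : nat, u < switch_time t (m + k)%N.
  exists (Num.trunc (u - switch_time t m)).+1.
  apply: lt_le_trans (grow _); rewrite -ltrBlDl.
  by rewrite truncnS_gt.
elim: k ku => [|k IH]; first by rewrite addn0 ltNge mu.
have -> : Posz (m + k.+1)%N = Posz (m + k)%N + 1 by rewrite addnS -addn1.
move=> uk; have [/IH//|ku] := ltP u (switch_time t (m + k)%N).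
by exists (m + k)%N; rewrite ?leq_addr ?ku.
Qed.

(** The index found is at most -2, the range in which the pseudo-orbits built below rest at the
    singularity. *)
Lemma backward_switch u : u < switch_time t (Negz 0) ->
  exists i : nat, switch_time t (Negz i.+1) <= u < switch_time t (Negz i.+1 + 1).
Proof.
move=> u0.
have grow k : switch_time t (Negz k) <= - k.+1%:R.
  elim: k => [|k IH]; first by rewrite /= big_ord_recr big_ord0 /= add0r lerN2.
  have := switch_timeS t (Negz k.+1); rewrite NegzS1 => E.
  have -> : switch_time t (Negz k.+1) = switch_time t (Negz k) - t (Negz k.+1).
    by rewrite E addrK.
  by rewrite -[k.+2%:R]natr1 opprD lerB.
have [k ku] : exists k : nat, switch_time t (Negz k) <= u.
  exists (Num.trunc (- u)); apply: (le_trans (grow _)); rewrite lerNl ltW//.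
  exact: truncnS_gt.
elim: k ku => [|k IH] ku; first by move: u0; rewrite ltNge ku.
have [/IH//|uk] := leP (switch_time t (Negz k)) u.
by exists k; rewrite ku NegzS1.
Qed.

End SwitchTimes.

(** * Counting the loops of orbits homoclinic to the singularity *)

Section HomoclinicLoops.
Variables (R : realType) (L : geometric_lorenz R).
Local Notation Phi := (gl_flow L).
Local Notation sigma := (gl_sing L).
Local Notation Lambda := (gl_attractor L).

Variables (b : 'rV[R]_3) (e : R).
Hypothesis e0 : 0 < e.
Hypothesis eb : 3 * e < `|b - sigma|.

(** The times may have any sign, so the notion is invariant under time shifts along the orbit. *)
Definition alternates (n : nat) (y : 'rV[R]_3) := exists tau : nat -> R,
  {homo tau : i j / (i < j)%N >-> i < j} /\ forall j, (j < n)%N ->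
    `|Phi (tau j.*2) y - sigma| <= e /\ `|Phi (tau j.*2.+1) y - b| <= e.

Definition homoclinic_loops (n : nat) (y : 'rV[R]_3) :=
  [/\ backward_near L e y,
      exists M, forall t, M <= t -> `|Phi t y - sigma| <= e & alternates n y].

Lemma flow_time_continuous y : continuous (fun t : R => Phi t y).
Proof.
move=> t; have [_ _ _ /(_ y t) [/derivable1_diffP/differentiable_continuous]] := gl_flowP L.
exact.
Qed.

Lemma far_from_both u v : `|u - b| <= e -> `|v - sigma| <= e -> e < `|u - v|.
Proof.
move=> ub vs; rewrite ltNge; apply/negP => uv; move: eb; rewrite ltNge => /negP; apply.
have -> : b - sigma = (b - u) + ((u - v) + (v - sigma)) by rewrite addrA subrKA subrKA.
apply: le_trans (ler_normD _ _) _.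
have : `|u - v + (v - sigma)| <= e + e by apply: le_trans (ler_normD _ _) _; exact: lerD.
by move: ub; rewrite distrC; lra.
Qed.

(** Visits to [b] occur only at times in []0, M[], and each passage from [b] to the singularity
    takes at least the modulus [r] of uniform continuity on [[0, M]]. Reading times along the orbit
    of [y] makes the bound independent of the shift [s]. *)
Lemma alternates_bounded m y : homoclinic_loops m y ->
  exists N, forall n s, alternates n (Phi s y) -> (n <= N)%N.
Proof.
move=> [ybwd [M yfwd] _].
have [r r0 rP] := @compact_uniform_continuity _ _ _ `[0, M] (fun t => Phi t y) e
  (@segment_compact _ 0 M) (fun t _ => @flow_time_continuous y t) e0.
exists (Num.trunc (M / r)).+1 => n s [tau [tau_incr tauP]].
rewrite leqNgt; apply/negP => Nn.
pose T j := tau j + s.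
have TP j : (j < n)%N ->
    `|Phi (T j.*2) y - sigma| <= e /\ `|Phi (T j.*2.+1) y - b| <= e.
  by move=> /tauP; rewrite -!flow_add.
have Todd j : (j < n)%N -> 0 < T j.*2.+1 < M.
  move=> /TP[_ Tb].
  have far : e < `|Phi (T j.*2.+1) y - sigma|.
    by apply: far_from_both Tb _; rewrite subrr normr0 ltW.
  by apply/andP; split; rewrite ltNge; apply/negP; [move=> /ybwd|move=> /yfwd];
    rewrite leNgt far.
have TS i j : (i < j)%N -> T i < T j by move=> /tau_incr; rewrite ltrD2r.
have gap j : (j < n)%N -> j%:R * r <= T j.*2.+1.
  elim: j => [/Todd/andP[/ltW T1 _]|j IH jn]; first by rewrite mul0r.
  have jn' := ltnW jn.
  have /andP[T0 _] := Todd j jn'; have /andP[_ TM] := Todd j.+1 jn.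
  have T12 := TS j.*2.+1 j.+1.*2 (ltnSn _); have T23 := TS _ _ (ltnSn j.+1.*2).
  have [_ Tb] := TP j jn'; have [Ts _] := TP j.+1 jn.
  have rT : r <= T j.+1.*2 - T j.*2.+1.
    rewrite leNgt; apply/negP => Tr; have := far_from_both Tb Ts.
    rewrite ltNge => /negP; apply; apply/ltW/rP.
    - by rewrite /= in_itv /= ltW//= ltW// (lt_trans T12) // (lt_trans T23).
    - by rewrite /= in_itv /= ltW ?(lt_trans T0)//= ltW// (lt_trans T23).
    - by rewrite distrC gtr0_norm// subr_gt0.
  by move: (IH jn') rT T23; rewrite -natr1 mulrDl mul1r; lra.
have := gap _ Nn; have /andP[_ TM] := Todd _ Nn; rewrite leNgt => /negP; apply.
by apply: lt_trans TM _; rewrite -ltr_pdivrMr// truncnS_gt.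
Qed.

Lemma homoclinic_loops_neq_sing n : ~ homoclinic_loops n.+1 sigma.
Proof.
move=> [_ _ [tau [_ /(_ 0%N isT)[s1 s2]]]].
have := far_from_both s2 s1; rewrite !sing_fixed subrr normr0.
by rewrite ltNge ltW.
Qed.

(* Pigeonhole: of three such orbits, two differ by a time shift. *)
Lemma homoclinic_loops_finite :
  (exists e1, e <= e1 /\ exists s : 'rV[R]_3 -> R,
    (forall y, backward_near L e1 y -> s y = 0 -> y = sigma) /\
    (forall y y', backward_near L e1 y -> backward_near L e1 y' ->
       0 < s y * s y' -> exists t, y' = Phi t y)) ->
  ~ forall n, exists y, homoclinic_loops n y.
Proof.
move=> [e1 [ee1 [s [s0 sP]]]] loops.
have bwd n y : homoclinic_loops n y -> backward_near L e1 y.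
  by move=> [yb _ _] t t0; apply: le_trans (yb t t0) ee1.
have sn0 n y : homoclinic_loops n.+1 y -> s y != 0.
  move=> yn; apply/eqP => /(s0 _ (bwd _ _ yn)) ys.
  by apply: (@homoclinic_loops_neq_sing n); rewrite -ys.
(* With coordinates of equal sign, [y'] would be a time shift of [y] and have more alternations than
   [N] allows. *)
have opp m y N n y' : homoclinic_loops m.+1 y ->
    (forall n t, alternates n (Phi t y) -> (n <= N)%N) ->
    homoclinic_loops n.+1 y' -> (N <= n)%N -> s y * s y' < 0.
  move=> ym yN y'n Nn; rewrite ltNge; apply/negP; rewrite le_eqVlt => /orP[|yy'].
    by rewrite eq_sym mulf_eq0 (negbTE (sn0 _ _ ym)) (negbTE (sn0 _ _ y'n)).
  have [t yt] := sP _ _ (bwd _ _ ym) (bwd _ _ y'n) yy'.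
  case: y'n => _ _; rewrite yt => /yN; rewrite leqNgt => /negP; apply.
  by rewrite ltnS.
(* Each new orbit is given more alternations than the earlier ones admit. The three coordinates
   would then have pairwise opposite signs. *)
have [y1 H1] := loops 1%N; have [N1 N1P] := alternates_bounded H1.
have [y2 H2] := loops N1.+1; have [N2 N2P] := alternates_bounded H2.
have [y3 H3] := loops (N1 + N2).+1.
have s12 := opp _ _ _ _ _ H1 N1P H2 (leqnn _).
have s13 := opp _ _ _ _ _ H1 N1P H3 (leq_addr _ _).
have s23 := opp _ _ _ _ _ H2 N2P H3 (leq_addl _ _).
have [y1n|y1p|y10] := ltgtP (s y1) 0; last by rewrite y10 mul0r ltxx in s12.
  rewrite nmulr_rlt0// in s12; rewrite nmulr_rlt0// in s13.
  by have := mulr_gt0 s12 s13; rewrite ltNge ltW.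
rewrite pmulr_rlt0// in s12; rewrite pmulr_rlt0// in s13.
by rewrite nmulr_rlt0// ltNge ltW in s23.
Qed.

End HomoclinicLoops.

(** * Pseudo-orbits with prescribed loops, and the orbits shadowing them *)

Section PseudoOrbits.
Variables (R : realType) (L : geometric_lorenz R).
Local Notation Phi := (gl_flow L).
Local Notation sigma := (gl_sing L).
Local Notation Lambda := (gl_attractor L).
Local Notation dist := (@euclidean_dist R).

Lemma attractor_invariant t u : Lambda u -> Lambda (Phi t u).
Proof.
move=> Lu; apply: attractor_closed => e e0.
have [r r0 rP] := flow_near L t u e0.
have [s [p [cp pu]]] := attractor_approximation Lu r0.
exists (Phi (t + s) p); split; first exact: flow_core_attractor.
by rewrite flow_add; exact: rP.
Qed.

(** The approximation is applied to [Phi 1 u] because the leg from [u] must last one unit of time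
    before the jump. *)
Lemma chain_to_sing u d : Lambda u -> 0 < d -> exists w t,
  [/\ Lambda w, 1 <= t, dist (Phi 1 u) w <= d & dist (Phi t w) sigma <= d].
Proof.
move=> Lu d0; have d2 : 0 < d / 2 by rewrite divr_gt0.
have [w [Lw wu ws]] := attractor_to_sing (@attractor_invariant 1 u Lu) d2.
have [M MP] := ws _ d2.
exists w, (Num.max 1 (M + 1)); split => //; first by rewrite le_max lexx.
  by apply: euclidean_lt; rewrite distrC.
by apply: euclidean_lt; apply: MP; rewrite lt_max [X in _ || X]ltrDl ltr01 orbT.
Qed.

Lemma chain_from_sing v d : Lambda v -> 0 < d -> exists w t,
  [/\ Lambda w, 1 <= t, dist (Phi 1 sigma) w <= d & dist (Phi t w) v <= d].
Proof.
move=> Lv d0; have d2 : 0 < d / 2 by rewrite divr_gt0.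
have [w [t [Lw ws t1 wv]]] := sing_to_attractor Lv d2.
exists w, t; split => //; apply: euclidean_lt => //.
by rewrite sing_fixed distrC.
Qed.

Let mod4S m n r : (m < 4 * n)%N -> (m %% 4 = r)%N -> (r < 3)%N ->
  (m.+1 < 4 * n)%N /\ (m.+1 %% 4 = r.+1)%N.
Proof.
move=> mn mr r3; have mr' : (m.+1 %% 4 = r.+1)%N.
  by rewrite -addn1 -modnDml mr addn1 modn_small.
split => //; rewrite ltn_neqAle mn andbT; apply/eqP => mE.
by move: mr'; rewrite mE modnMr.
Qed.

Let mod4_3 m r : (m %% 4 = r.+3)%N -> m.+1 = (4 * (m %/ 4).+1)%N.
Proof.
move=> mr; have := ltn_pmod m (isT : (0 < 4)%N); rewrite mr; case: r mr => // mr _.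
by rewrite mulnS mulnC {1}(divn_eq m 4) mr -addnS addnC.
Qed.

Lemma loops_pseudo_orbit p b n d : Lambda p -> Lambda b -> 0 < d -> exists x t,
  [/\ pseudo_orbit dist Lambda Phi d 1 x t, x 0 = p,
      forall m, x (Negz m.+1) = sigma,
      forall m, (4 * n <= m)%N -> x (Posz m.+2) = sigma &
      forall j, (j < n)%N ->
        x (Posz (4 * j).+2) = sigma /\ x (Posz (4 * j).+4) = b].
Proof.
move=> Lp Lb d0.
have [p0 [tp0 [Lp0 tp01 sp0 p0p]]] := chain_from_sing Lp d0.
have [p1 [tp1 [Lp1 tp11 pp1 p1s]]] := chain_to_sing Lp d0.
have [b0 [tb0 [Lb0 tb01 sb0 b0b]]] := chain_from_sing Lb d0.
have [b1 [tb1 [Lb1 tb11 bb1 b1s]]] := chain_to_sing Lb d0.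
(* The sequence rests at [sigma] up to index -2, passes [p0], [p], [p1] at -1, 0, 1, then runs [n]
   blocks [sigma, b0, b, b1] from index 2 on, and finally rests at [sigma]. *)
pose z (i : int) : 'rV[R]_3 * R := match i with
  | Posz 0 => (p, 1)
  | Posz 1 => (p1, tp1)
  | Posz m.+2 => if (m < 4 * n)%N then
      match (m %% 4)%N with
      | 0 => (sigma, 1) | 1 => (b0, tb0) | 2 => (b, 1) | _ => (b1, tb1)
      end else (sigma, 1)
  | Negz 0 => (p0, tp0)
  | Negz _ => (sigma, 1)
  end.
have Ls : Lambda sigma by exact: sing_attractor.
have ss : dist (Phi 1 sigma) sigma <= d.
  by apply: euclidean_lt; rewrite sing_fixed subrr normr0 divr_gt0.
have zs m : (4 * n <= m)%N -> z (Posz m.+2) = (sigma, 1).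
  by rewrite /= leqNgt => /negbTE ->.
(* No bound on [j] is imposed: the entry after a block is [sigma], be it the start of the next block
   or of the final rest. *)
have z0 j : z (Posz (4 * j).+2) = (sigma, 1).
  by rewrite /= modnMr; case: ifP.
exists (fun i => (z i).1), (fun i => (z i).2); split => //.
- case=> [[|[|m]]|[|m]].
  + by split.
  + have z2 : z 2 = (sigma, 1) by exact: (z0 0%N).
    by split => //; rewrite -[z (1 + 1)]/(z 2) z2.
  + have -> : Posz m.+2 + 1 = Posz m.+3 by rewrite -PoszD addn1.
    have [mn|nm] := ltnP m (4 * n); last first.
      by rewrite !zs ?(leq_trans nm)//; split.
    case E : (m %% 4)%N => [|[|[|r]]].
    * have [mn' E'] := mod4S mn E isT.
      by rewrite /= mn mn' E E'; split.
    * have [mn' E'] := mod4S mn E isT.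
      by rewrite /= mn mn' E E'; split.
    * have [mn' E'] := mod4S mn E isT.
      by rewrite /= mn mn' E E'; split.
    * have -> : m.+3 = (4 * (m %/ 4).+1).+2 by rewrite -(mod4_3 E).
      by rewrite z0 /= mn E; split.
  + by split.
  + by rewrite NegzS1; case: m => [|m]; split.
- by move=> m /zs ->.
- move=> j jn; rewrite z0; split => //=.
  have -> : ((4 * j).+2 < 4 * n)%N.
    by apply: (@leq_trans (4 * j.+1)); rewrite ?leq_mul2l// mulnS -addn3 addnC leq_add2r.
  by have -> : ((4 * j).+2 %% 4 = 2)%N by rewrite -addn2 mulnC modnMDl.
Qed.

Lemma shadowed_homoclinic_loops p b n d e : Lambda p -> Lambda b -> 0 < d ->
  (forall x t, pseudo_orbit dist Lambda Phi d 1 x t -> x 0 = p ->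
     shadowed dist Lambda Phi e x t) ->
  exists y, homoclinic_loops L b e n y.
Proof.
move=> Lp Lb d0 tracing.
have [x [t [xt xp xneg xpos xloop]]] := loops_pseudo_orbit n Lp Lb d0.
have [y [h [Ly [h_incr h_surj h0] hP]]] := tracing x t xt xp.
have t1 i : 1 <= t i by have [] := xt i.
pose s := switch_time t.
have h_le u v : u <= v -> h u <= h v.
  by rewrite le_eqVlt => /orP[/eqP ->//|/h_incr/ltW].
have Phi0 q : Phi 0 q = q by have [->] := gl_flowP L.
have close q v : dist q (Phi v y) <= e -> `|Phi v y - q| <= e.
  by rewrite distrC; apply: le_trans; exact: norm_le_euclidean.
have at_switch i : `|Phi (h (s i)) y - x i| <= e.
  apply: close; have := hP (s i) i; rewrite subrr Phi0; apply.
  by rewrite /s switch_timeS lexx ltrDl (lt_le_trans ltr01).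
(* Subtracting 1 puts every parameter [u] with [h u <= A] strictly before the leg of [p0]. As [h] is
   onto, the whole backward orbit of [Phi A y] then shadows the rest at [sigma]. *)
pose A := h (s (Negz 0)) - 1.
exists (Phi A y); split.
- move=> v v0; rewrite -flow_add; have [u uv] := h_surj (v + A); rewrite -uv.
  have us : u < s (Negz 0).
    rewrite ltNge; apply/negP => /h_le; rewrite uv leNgt => /negP; apply.
    by rewrite /A; lra.
  have [i iu] := backward_switch t1 us.
  by apply: close; have := hP u _ iu; rewrite xneg sing_fixed.
- exists (h (s (Posz (4 * n).+2)) - A) => v vM.
  rewrite -flow_add; have [u uv] := h_surj (v + A); rewrite -uv.
  have us : s (Posz (4 * n).+2) <= u.
    rewrite leNgt; apply/negP => /h_incr; rewrite uv ltNge => /negP; apply.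
    by rewrite -lerBlDr.
  have [i ni iu] := forward_switch t1 us.
  apply: close; have := hP u _ iu.
  case: i ni {iu} => [//|[//|i]] ni.
  by rewrite xpos// sing_fixed.
(* Every second switch is kept: even [m] gives the indices [4j + 2] of [sigma], odd [m] the indices
   [4j + 4] of [b]. *)
exists (fun m => h (s (Posz (2 * m).+2)) - A); split.
  move=> i j ij; rewrite ltrD2r; apply: h_incr; apply: switch_time_increasing => //.
  by lia.
move=> j /xloop[xs xb]; rewrite -!flow_add !subrK.
have -> : (2 * j.*2).+2 = (4 * j).+2 by lia.
have -> : (2 * j.*2.+1).+2 = (4 * j).+4 by lia.
by have := at_switch (4 * j).+2; have := at_switch (4 * j).+4; rewrite xs xb.
Qed.

End PseudoOrbits.

Theorem corollary2p14 (R : realType) (L : geometric_lorenz R)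
  (hf : gl_f L 0 <> 0 \/ gl_f L 1 <> 1) :
  Sh euclidean_dist (gl_attractor L) (gl_flow L) = set0.
Proof.
rewrite -subset0 => p [Lp tracing].
(* Any point of the attractor other than the singularity could serve as [b]; a core point on the
   section is one. *)
have [y sy cy] := core_Gamma L.
set b := gl_sec L _ in cy.
have Lb : gl_attractor L b.
  by have [Phi0 _ _ _] := gl_flowP L; rewrite -(Phi0 b); exact: flow_core_attractor.
have bs : 0 < `|b - gl_sing L|.
  by rewrite normr_gt0 subr_eq0; apply/eqP; exact: sec_neq_sing.
have [e1 e10 sP] := backward_near_sing L.
(* The first bound keeps backward orbits in the linearizing chart; the second separates the balls
   around [b] and the singularity. *)
pose e := Num.min e1 (`|b - gl_sing L| / 4).
have e0 : 0 < e by rewrite lt_min e10 divr_gt0.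
have eb : 3 * e < `|b - gl_sing L|.
  have : e <= `|b - gl_sing L| / 4 by rewrite ge_min lexx orbT.
  by move: bs; lra.
have [d d0 dP] := tracing e e0.
apply: (homoclinic_loops_finite e0 eb).
  by exists e1; split => //; rewrite ge_min lexx.
by move=> n; exact: shadowed_homoclinic_loops Lp Lb d0 dP.
Qed.
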